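(* Let $\Omega$ be a bounded open set in $\mathbb{R}^n$, let $p\in\mathcal{P}_\infty(\overline\Omega)\cap w\text{-}Lip(\overline\Omega)$, and let $\mathfrak F$ be a subset of $L^{p(\cdot)}(\overline\Omega)$. Then $\mathfrak F$ is relatively compact in $L^{p(\cdot)}(\overline\Omega)$ (i.e. its closure is compact) if and only if $$\lim_{h\to 0}\|f_h-f\|_{p(\cdot)}=0\quad\text{uniformly for } f\in\mathfrak F,$$ i.e. for every $\varepsilon>0$ there is $h_0>0$ such that $\|f_h-f\|_{p(\cdot)}<\varepsilon$ for all $0<h<h_0$ and all $f\in\mathfrak F$. Here $f_h$ is the Steklov function of $f$ and $\|\cdot\|_{p(\cdot)}$ is the norm of $L^{p(\cdot)}(\overline\Omega)$.
   Context: Let $E\subseteq\mathbb{R}^n$ be an open or closed set (here $E=\overline\Omega$). An exponent on $E$ is a measurable function $p:E\to[1,\infty)$; note that $\inf p=1$ is allowed. Variable exponent Lebesgue space: $L^{p(\cdot)}(E)$ is the space of (a.e. equivalence classes of) real-valued measurable functions $f$ on $E$ with $I_p(f)=\int_E |f(x)|^{p(x)}\,dx<\infty$ (for exponents in $L^\infty(E)$, as below, this is a vector space), with the norm $\|f\|_{p(\cdot)}=\inf\{\lambda>0: I_p(f/\lambda)\le 1\}$, for which it is a Banach space. $w\text{-}Lip(E)$ is the class of exponents $p\in L^\infty(E)$ for which there is $C>0$ with $|p(x)-p(y)|\le \frac{C}{-\ln|x-y|}$ for all $x,y\in E$ with $0<|x-y|\le\frac12$. $\mathcal P_\infty(E)$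 is the class of exponents $p\in L^\infty(E)$ for which there exists $p(\infty)=\lim_{E\ni x\to\infty}p(x)$ and there is $C>0$ with $|p(x)-p(\infty)|\le\frac{C}{\ln(2+|x|)}$ for all $x\in E$. When $E$ is bounded, this imposes no restriction on $p\in L^\infty(E)$. Steklov function: for $f\in L^{p(\cdot)}(E)$ and $h>0$, $f_h(x)=\frac{1}{v_nh^n}\int_{B(x,h)}f(t)\,dt$, where $v_n=|B(0,1)|$ is the volume of the unit ball, $B(x,h)$ is the ball of center $x$ and radius $h$, and $f$ is extended by zero outside $E$. In the norm $\|f_h-f\|_{p(\cdot)}$, $f_h$ is considered as a function on $E$. *)

(* Defs.v *)
From HB Require Import structures.
From mathcomp Require Import all_boot all_order all_algebra.
From mathcomp Require Import ring_quotient.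
From mathcomp Require Import all_classical all_reals all_analysis.
From mathcomp Require Import measurable_realfun.

Set Implicit Arguments.
Unset Strict Implicit.
Unset Printing Implicit Defensive.

Import Order.TTheory GRing.Theory Num.Theory.
Import numFieldNormedType.Exports.

Local Open Scope classical_set_scope.
Local Open Scope ring_scope.

(* The sigma-algebra on 'M[R]_(m, n) is the Borel one. *)
Section borel_mx.
Variables (R : realType) (m n : nat).

HB.instance Definition _ := @isMeasurable.Build
  (sigma_display (@open 'M[R]_(m, n))) 'M[R]_(m, n)
  <<s @open 'M[R]_(m, n) >> (@sigma_algebra0 _ setT _) (@sigma_algebraC _ _)
  (@sigma_algebra_bigcup _ setT _).

Lemma open_measurable_mx (U : set 'M[R]_(m, n)) : open U -> measurable U.
Proof. exact: sub_sigma_algebra. Qed.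

Lemma closed_measurable_mx (F : set 'M[R]_(m, n)) : closed F -> measurable F.
Proof.
by rewrite -openC => /open_measurable_mx/measurableC; rewrite setCK.
Qed.

Lemma measurable_coord_mx (i : 'I_m) (j : 'I_n) :
  measurable_fun [set: 'M[R]_(m, n)] (fun M => M i j).
Proof.
apply: (measurability _ (RGenOpens.measurableE R)) => _ [_ [a [b ->] <-]].
rewrite setTI; apply: open_measurable_mx.
by apply: open_comp; [move=> x _; exact: coord_continuous|exact: interval_open].
Qed.

Let rbox (q : 'M[rat]_(m, n) * rat) : set 'M[R]_(m, n) :=
  [set M | forall i j, `|ratr (q.1 i j) - M i j| < ratr q.2].

Let open_rbox (U : set 'M[R]_(m, n)) : open U ->
  U = \bigcup_(q in [set q | rbox q `<=` U]) rbox q.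
Proof.
rewrite openE => oU; apply/seteqP; split; last by move=> x [q /= + qx]; exact.
move=> M /oU; rewrite /interior => /nbhs_ballP[/= e e0 eU].
have [r /andP[r0 re]] : exists r : rat, (0:R) < ratr r < e / 2.
  have [|r] := @rat_in_itvoo R 0 (e / 2); first by rewrite divr_gt0.
  by rewrite in_itv/=; exists r.
have /choice[q qM] : forall ij : 'I_m * 'I_n,
    exists q : rat, `|ratr q - M ij.1 ij.2| < (ratr r : R).
  move=> [i j]/=; have [|q] := @rat_in_itvoo R (M i j) (M i j + ratr r).
    by rewrite ltrDl.
  rewrite in_itv/= => /andP[q1 q2]; exists q.
  by rewrite ger0_norm ?subr_ge0 ?(ltW q1)// ltrBlDl.
exists (\matrix_(i, j) q (i, j), r) => /=; last first.
  by move=> i j /=; rewrite mxE; exact: (qM (i, j)).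
move=> N NN; apply: eU; split => // i j; rewrite /ball/=.
rewrite (le_lt_trans (ler_distD (ratr (q (i, j))) _ _))//.
rewrite (splitr e) ltrD//; first by rewrite distrC (lt_trans (qM (i, j))).
by have := NN i j; rewrite /= mxE => /lt_trans; exact.
Qed.

Lemma measurable_fun_mx d (T : measurableType d) (f : T -> 'M[R]_(m, n)) :
  (forall i j, measurable_fun [set: T] (fun t => f t i j)) ->
  measurable_fun [set: T] f.
Proof.
move=> mf; apply: (measurability (@open 'M[R]_(m, n))) => // _ [U oU <-].
rewrite setTI (open_rbox oU) preimage_bigcup bigcup_mkcond.
apply: countable_bigcupT_measurable => [|q]; first exact: countableP.
case: ifPn => // _.
have -> : f @^-1` rbox q =
    \bigcap_(i in [set: 'I_m]) \bigcap_(j in [set: 'I_n])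
      [set t | `|ratr (q.1 i j) - f t i j| < ratr q.2].
  by apply/seteqP; split=> t /=; [move=> h i _ j _|move=> h i j]; exact: h.
apply: fin_bigcap_measurable => // i _.
apply: fin_bigcap_measurable => // j _.
rewrite -[X in measurable X]setTI.
have mg : measurable_fun [set: T] (fun t => `|ratr (q.1 i j) - f t i j|).
  by apply: measurableT_comp => //; exact: measurable_funB.
have := mg measurableT `]-oo, ratr q.2[%classic (measurable_itv _).
by congr measurable; apply/seteqP; split=> t /=; rewrite in_itv.
Qed.

End borel_mx.

Section lebesgue_rV.
Variable R : realType.

Definition cons_rV n (z : 'rV[R]_n * measurableTypeR R) : 'rV[R]_n.+1 :=
  row_mx (\row_(_ < 1) z.2) z.1.

Lemma cons_rV_ord0 n (z : 'rV[R]_n * measurableTypeR R) i :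
  cons_rV z i ord0 = z.2.
Proof.
rewrite /cons_rV (_ : ord0 = lshift n (ord0 : 'I_1)); last exact: val_inj.
by rewrite [LHS](@row_mxEl _ 1 1 n) mxE.
Qed.

Lemma cons_rV_lift n (z : 'rV[R]_n * measurableTypeR R) i j :
  cons_rV z i (lift ord0 j) = z.1 i j.
Proof.
rewrite /cons_rV (_ : lift ord0 j = rshift 1 j); last exact: val_inj.
by rewrite [LHS](@row_mxEr _ 1 1 n).
Qed.

Lemma measurable_cons_rV n : measurable_fun [set: _] (@cons_rV n).
Proof.
apply: measurable_fun_mx => i j; case: (unliftP ord0 j) => [k ->|->].
  under eq_fun do rewrite cons_rV_lift.
  apply: (measurableT_comp (f := fun M : 'rV[R]_n => M i k)).
    exact: measurable_coord_mx.
  exact: measurable_fst.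
under eq_fun do rewrite cons_rV_ord0.
exact: (@measurable_snd _ _ 'rV[R]_n (measurableTypeR R)).
Qed.

(* Built by adding one coordinate at a time; see lebesgue_rV_box for its values
   on products. *)
Fixpoint lebesgue_rV n : {measure set 'rV[R]_n -> \bar R} :=
  if n is n'.+1 then
    measure_function_pushforward__canonical__measure_function_Measure
      (lebesgue_rV n' \x @lebesgue_measure R)%E (@measurable_cons_rV n')
  else \d_(0 : 'rV[R]_0).

Lemma lebesgue_rV_box n (A : 'I_n -> set (measurableTypeR R)) :
  (forall i, measurable (A i)) ->
  (lebesgue_rV n [set x | forall i, A i (x ord0 i)] =
   \prod_(i < n) lebesgue_measure (A i))%E.
Proof.
elim: n A => [A _|n IH A mA] /=.
  rewrite big_ord0 diracE mem_set//=.
  by case=> i i0; exfalso; move: i0; rewrite ltn0.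
rewrite big_ord_recl /pushforward.
pose B : set 'rV[R]_n := [set x | forall i, A (lift ord0 i) (x ord0 i)].
rewrite (_ : _ @^-1` _ = B `*` A ord0); last first.
  apply/seteqP; split=> [[x t] h|[x t] [/= hB hA] i].
    split=> [i/=|/=]; first by have := h (lift ord0 i); rewrite cons_rV_lift.
    by have := h ord0; rewrite cons_rV_ord0.
  by case: (unliftP ord0 i) => [j ->|->]; rewrite ?cons_rV_lift ?cons_rV_ord0.
have mB : measurable B.
  rewrite (_ : B = \bigcap_(i in [set: 'I_n])
      ((fun x : 'rV[R]_n => x ord0 i) @^-1` A (lift ord0 i))); last first.
    by apply/seteqP; split=> x /=; [move=> h i _|move=> h i]; exact: h.
  apply: fin_bigcap_measurable => // i _; rewrite -[X in measurable X]setTI.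
  by apply: measurable_coord_mx => //; exact: mA.
rewrite [LHS]product_measure1E// muleC; congr (_ * _)%E.
by apply: IH => i; exact: mA.
Qed.

End lebesgue_rV.
Arguments lebesgue_rV {R} n.

(* The library norm of 'rV[R]_n is the max norm, hence this separate one. *)
Definition euclid_norm (R : realType) n (x : 'rV[R]_n) : R :=
  Num.sqrt (\sum_(i < n) x ord0 i ^+ 2).

Definition euclid_ball (R : realType) n (x : 'rV[R]_n) (r : R) : set 'rV[R]_n :=
  [set y | euclid_norm (y - x) < r].

(* Exponents in L^oo(E), for which L^{p(.)}(E) is a vector space. The values of
   p outside E are neither constrained nor used. *)
Record bounded_exponent (R : realType) n (E : set 'rV[R]_n) := BoundedExponent {
  exponent_fun :> 'rV[R]_n -> R ;
  exponent_dom : open E \/ closed E ;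
  measurable_exponent : measurable_fun E exponent_fun ;
  exponent_ge1 : forall x, E x -> 1 <= exponent_fun x ;
  exponent_Linfty :
    exists M, {ae lebesgue_rV n, forall x, E x -> `|exponent_fun x| <= M} }.

Section modular.
Variables (R : realType) (n : nat) (E : set 'rV[R]_n) (p : bounded_exponent E).
Implicit Types f g : 'rV[R]_n -> R.

Let mu : {measure set 'rV[R]_n -> \bar R} := lebesgue_rV n.

Definition modular f : \bar R := (\int[mu]_(x in E) (`|f x| `^ p x)%:E)%E.

(* The infimum is taken in the extended reals, so that it is +oo, and not 0,
   when no admissible l exists. *)
Definition luxemburg_norm f : \bar R :=
  ereal_inf [set l%:E | l in
    [set l : R | 0 < l /\ (modular (fun x => (f x / l)%R) <= 1)%E]].

Lemma measurable_exponent_dom : measurable E.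
Proof.
by case: (exponent_dom p) => [/open_measurable_mx|/closed_measurable_mx].
Qed.
Local Notation mE := measurable_exponent_dom.

Let p_neq0 x : E x -> p x != 0.
Proof. by move=> Ex; rewrite gt_eqF// (lt_le_trans ltr01)// exponent_ge1. Qed.

Let p_ge0 x : E x -> 0 <= p x.
Proof. by move=> Ex; rewrite (le_trans ler01)// exponent_ge1. Qed.

Lemma measurable_modular f : measurable_fun E f ->
  measurable_fun E (fun x => (`|f x| `^ p x)%:E).
Proof.
move=> mf; apply/measurable_EFinP.
have mn : measurable_fun E (fun x => `|f x|) by exact: measurableT_comp.
rewrite /powR; apply: measurable_fun_if; first exact: mE.
- exact: measurable_fun_eqr.
- apply: measurableT_comp => //.
  apply: measurableT_comp => //; apply: (measurable_funS mE) => //.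
  apply: measurable_fun_eqr => //; exact: measurable_exponent.
- apply: measurableT_comp => //; apply: measurable_funM.
    by apply: (measurable_funS mE) => //; exact: measurable_exponent.
  by apply: measurableT_comp => //; exact: (measurable_funS mE).
Qed.

Lemma modular_ge0 f : (0 <= modular f)%E.
Proof. by apply: integral_ge0 => x _; rewrite lee_fin powR_ge0. Qed.

Lemma modular0 : modular (fun=> 0) = 0%E.
Proof.
by rewrite /modular integral0_eq// => x Ex; rewrite normr0 powR0// p_neq0.
Qed.

Lemma modular_ae_eq f g : measurable_fun E f -> measurable_fun E g ->
  {ae mu, forall x, E x -> f x = g x} -> modular f = modular g.
Proof.
move=> mf mg fg; apply: ge0_ae_eq_integral; first exact: mE.
- exact: measurable_modular.
- exact: measurable_modular.
- by move=> x _; rewrite lee_fin powR_ge0.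
- by move=> x _; rewrite lee_fin powR_ge0.
- by apply: filterS fg => x + Ex => /(_ Ex) ->.
Qed.

Lemma le_modular f g : measurable_fun E f -> measurable_fun E g ->
  (forall x, E x -> `|f x| <= `|g x|) -> (modular f <= modular g)%E.
Proof.
move=> mf mg fg; apply: ge0_le_integral; first exact: mE.
- by move=> x _; rewrite lee_fin powR_ge0.
- exact: measurable_modular.
- exact: measurable_modular.
- move=> x Ex; rewrite lee_fin ge0_ler_powR ?nnegrE// ?p_ge0//.
  exact: fg.
Qed.

Let powR_conv (q t a b : R) : 1 <= q -> 0 <= t -> t <= 1 -> 0 <= a -> 0 <= b ->
  (t * a + (1 - t) * b) `^ q <= t * a `^ q + (1 - t) * b `^ q.
Proof.
move=> q1 t0 t1 a0 b0; have := @convex_powR R q q1 (Itv01 t0 t1) a b.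
by rewrite !inE/= !in_itv/= !andbT => /(_ a0 b0); rewrite /conv/=.
Qed.

Let modularZl (k : R) f : measurable_fun E f -> 0 <= k ->
  (k%:E * modular f = \int[mu]_(x in E) (k * `|f x| `^ p x)%:E)%E.
Proof.
move=> mf k0; apply/esym.
have f0 x : E x -> (0 <= (`|f x| `^ p x)%:E)%E by rewrite lee_fin powR_ge0.
exact: (ge0_integralZl_EFin mu mE f0 (measurable_modular mf) k0).
Qed.

Lemma modular_convex (t : R) f g : measurable_fun E f -> measurable_fun E g ->
  0 <= t -> t <= 1 ->
  (modular (fun x => (t * f x + (1 - t) * g x)%R)
     <= t%:E * modular f + (1 - t)%:E * modular g)%E.
Proof.
move=> mf mg t0 t1; have t1' : 0 <= 1 - t by rewrite subr_ge0.
have mZ (k : R) (h : 'rV[R]_n -> R) : measurable_fun E h -> measurable_fun E (fun x => k * h x).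
  by move=> mh; exact: measurable_funM.
have me (k : R) (h : 'rV[R]_n -> R) : measurable_fun E h ->
    measurable_fun E (fun x => (k * `|h x| `^ p x)%:E).
  move=> mh; under eq_fun do rewrite EFinM.
  by apply: emeasurable_funM => //; exact: measurable_modular.
have e0 (k : R) (h : 'rV[R]_n -> R) : 0 <= k ->
    forall x, E x -> (0 <= (k * `|h x| `^ p x)%:E)%E.
  by move=> k0 x _; rewrite lee_fin mulr_ge0// powR_ge0.
rewrite !modularZl//.
rewrite -(ge0_integralD mu mE (e0 t f t0) (me t f mf) (e0 _ g t1') (me _ g mg)).
apply: ge0_le_integral; first exact: mE.
- by move=> x _; rewrite lee_fin powR_ge0.
- by apply: measurable_modular; apply: measurable_funD; exact: mZ.
- by apply: emeasurable_funD; exact: me.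
move=> x Ex; rewrite -EFinD lee_fin.
apply: le_trans (powR_conv _ t0 t1 (normr_ge0 (f x)) (normr_ge0 (g x))).
  rewrite ge0_ler_powR ?p_ge0 ?nnegrE ?addr_ge0 ?mulr_ge0//.
  rewrite (le_trans (ler_normD _ _))// !normrM.
  by rewrite (ger0_norm t0) (ger0_norm t1').
exact: exponent_ge1.
Qed.

Lemma modularZ_le (k : R) f : measurable_fun E f -> 0 <= k -> k <= 1 ->
  (modular (fun x => (k * f x)%R) <= k%:E * modular f)%E.
Proof.
move=> mf k0 k1; have m0 : measurable_fun E (fun=> 0 : R) by exact: measurable_cst.
have := modular_convex mf m0 k0 k1; rewrite modular0 mule0 adde0.
by under eq_fun do rewrite mulr0 addr0.
Qed.

Lemma modularZ_lty (k : R) f : measurable_fun E f -> (modular f < +oo)%E ->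
  (modular (fun x => (k * f x)%R) < +oo)%E.
Proof.
move=> mf foo; have [M pM] := exponent_Linfty p.
pose K := Num.max 1 `|k|.
have K1 : 1 <= K by rewrite le_max lexx.
have K0 : 0 <= K by rewrite (le_trans ler01).
apply: (@le_lt_trans _ _ ((K `^ M)%:E * modular f)%E); last first.
  by rewrite lte_mul_pinfty ?lee_fin ?powR_ge0// ge0_fin_numE// modular_ge0.
rewrite modularZl ?powR_ge0//.
apply: ae_ge0_le_integral; first exact: mE.
- by move=> x _; rewrite lee_fin powR_ge0.
- by apply: measurable_modular; exact: measurable_funM.
- by move=> x _; rewrite lee_fin mulr_ge0// powR_ge0.
- under eq_fun do rewrite EFinM.
  by apply: emeasurable_funM => //; exact: measurable_modular.
apply: filterS pM => x /= + Ex => /(_ Ex) pxM.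
rewrite lee_fin normrM powRM// ler_wpM2r ?powR_ge0//.
apply: (@le_trans _ _ (K `^ p x)).
  by rewrite ge0_ler_powR ?p_ge0 ?nnegrE// le_max lexx orbT.
by rewrite ler_powR// (le_trans _ pxM)// ler_norm.
Qed.

Lemma modularD_lty f g : measurable_fun E f -> measurable_fun E g ->
  (modular f < +oo)%E -> (modular g < +oo)%E ->
  (modular (fun x => (f x + g x)%R) < +oo)%E.
Proof.
move=> mf mg foo goo; pose h x := 2^-1 * f x + (1 - 2^-1) * g x.
have mh : measurable_fun E h by apply: measurable_funD; exact: measurable_funM.
have -> : (fun x => f x + g x) = (fun x => 2 * h x).
  apply/funext => x; rewrite /h.
  have -> : (1 - 2^-1 : R) = 2^-1 by rewrite [X in X - _](splitr 1) div1r addrK.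
  by rewrite -mulrDr mulrA divff// mul1r.
apply: (modularZ_lty 2 mh).
have h01 : (0 : R) <= 2^-1 by rewrite invr_ge0.
have h1 : (2^-1 : R) <= 1 by rewrite invf_le1// ler1n.
apply: le_lt_trans (modular_convex mf mg h01 h1) _.
have lty (k : R) (x : \bar R) : 0 <= k -> (0 <= x -> x < +oo -> k%:E * x < +oo)%E.
  by move=> k0 x0 xoo; rewrite lte_mul_pinfty// ge0_fin_numE.
by apply: lte_add_pinfty; apply: lty; rewrite ?subr_ge0 ?modular_ge0.
Qed.

Lemma luxemburg_norm_ge0 f : (0 <= luxemburg_norm f)%E.
Proof. by apply/ereal_infP => _ [l [l0 _] <-]; rewrite lee_fin ltW. Qed.

Lemma luxemburg_norm_le f a : 0 < a ->
  (modular (fun x => (f x / a)%R) <= 1)%E -> (luxemburg_norm f <= a%:E)%E.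
Proof. by move=> a0 fa; apply: ereal_inf_lbound; exists a. Qed.

Let measurable_divr f (k : R) :
  measurable_fun E f -> measurable_fun E (fun x => f x / k).
Proof. by move=> mf; under eq_fun do rewrite mulrC; exact: measurable_funM. Qed.

Lemma luxemburg_norm_lt f a : measurable_fun E f ->
  (luxemburg_norm f < a%:E)%E -> (modular (fun x => (f x / a)%R) <= 1)%E.
Proof.
move=> mf /ereal_inf_lt[_ [l [l0 fl] <-]]; rewrite lte_fin => la.
apply: le_trans fl; apply: le_modular.
- exact: measurable_divr.
- exact: measurable_divr.
move=> x _; have a0 := lt_trans l0 la.
rewrite !normrM ler_wpM2l// !gtr0_norm ?invr_gt0//.
by rewrite lef_pV2 ?posrE// ltW.
Qed.

Lemma luxemburg_norm_lty f : measurable_fun E f -> (modular f < +oo)%E ->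
  (luxemburg_norm f < +oo)%E.
Proof.
move=> mf foo; have ffin : modular f \is a fin_num.
  by rewrite ge0_fin_numE// modular_ge0.
pose a := Num.max 1 (fine (modular f)).
have a1 : 1 <= a by rewrite le_max lexx.
have a0 : 0 < a by rewrite (lt_le_trans ltr01).
apply: (@le_lt_trans _ _ a%:E); last exact: ltry.
apply: luxemburg_norm_le => //.
have aV : 0 <= a^-1 by rewrite invr_ge0 ltW.
have aV1 : a^-1 <= 1 by rewrite invf_le1.
have := modularZ_le mf aV aV1; under eq_fun do rewrite mulrC.
move=> /le_trans; apply.
rewrite -(fineK ffin) -EFinM lee_fin mulrC ler_pdivrMr// mul1r.
by rewrite le_max lexx orbT.
Qed.

Lemma luxemburg_norm_ae_eq f g : measurable_fun E f -> measurable_fun E g ->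
  {ae mu, forall x, E x -> f x = g x} -> luxemburg_norm f = luxemburg_norm g.
Proof.
move=> mf mg fg.
have fgl l : modular (fun x => f x / l) = modular (fun x => g x / l).
  apply: modular_ae_eq; [exact: measurable_divr|exact: measurable_divr|].
  by apply: filterS fg => x + Ex => /(_ Ex) ->.
apply/le_anti/andP; split; apply/ereal_infP => _ [l [l0 hl] <-].
  by apply: luxemburg_norm_le; [exact: l0|rewrite fgl; exact: hl].
by apply: luxemburg_norm_le; [exact: l0|rewrite -fgl; exact: hl].
Qed.

End modular.

Section Lvar.
Variables (R : realType) (n : nat) (E : set 'rV[R]_n) (p : bounded_exponent E).

Let mu : {measure set 'rV[R]_n -> \bar R} := lebesgue_rV n.

Definition Lvar_pred : {pred 'rV[R]_n -> R} :=
  [pred f | `[< measurable_fun E f /\ (modular p f < +oo)%E >]].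

Lemma Lvar_submod_closed : submod_closed Lvar_pred.
Proof.
split=> [|a f g].
  apply/asboolP; split; first exact: measurable_cst.
  by have -> : modular p 0 = 0%E by exact: modular0.
move=> /asboolP[mf foo] /asboolP[mg goo]; apply/asboolP.
have maf : measurable_fun E (fun x => a * f x) by exact: measurable_funM.
split; first exact: (measurable_funD maf mg).
exact: (modularD_lty maf mg (modularZ_lty a mf foo) goo).
Qed.

HB.instance Definition _ :=
  GRing.isSubmodClosed.Build R ('rV[R]_n -> R) Lvar_pred Lvar_submod_closed.

Record Lvar_fun := LvarFun {
  Lvar_val :> 'rV[R]_n -> R ;
  Lvar_valP : Lvar_val \in Lvar_pred }.

HB.instance Definition _ := [isSub for Lvar_val].
HB.instance Definition _ := [Choice of Lvar_fun by <:].
HB.instance Definition _ := [SubChoice_isSubLmodule of Lvar_fun by <:].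

Lemma measurable_Lvar (f : Lvar_fun) : measurable_fun E f.
Proof. by case: f => f /= /asboolP[]. Qed.

Lemma modular_Lvar_lty (f : Lvar_fun) : (modular p f < +oo)%E.
Proof. by case: f => f /= /asboolP[]. Qed.

Let LvarBE (f g : Lvar_fun) x : (f - g : Lvar_fun) x = f x - g x.
Proof. by []. Qed.

Let LvarDE (f g : Lvar_fun) x : (f + g : Lvar_fun) x = f x + g x.
Proof. by []. Qed.

Let LvarZE (a : R) (f : Lvar_fun) x : (a *: f : Lvar_fun) x = a * f x.
Proof. by []. Qed.

(* The elements vanishing a.e. on E; values outside E are irrelevant. *)
Definition Lvar_null : {pred Lvar_fun} :=
  [pred f : Lvar_fun | `[< {ae mu, forall x, E x -> f x = 0} >]].

Lemma Lvar_null_zmod_closed : zmod_closed Lvar_null.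
Proof.
split=> [|f g]; first by apply/asboolP/aeW.
move=> /asboolP f0 /asboolP g0; apply/asboolP.
apply: filterS2 f0 g0 => x fx gx Ex.
by rewrite LvarBE fx// gx// subrr.
Qed.

HB.instance Definition _ :=
  GRing.isZmodClosed.Build Lvar_fun Lvar_null Lvar_null_zmod_closed.

(* L^{p(.)}(E): classes modulo a.e. equality on E. Representatives are Borel
   measurable, which loses no class since every Lebesgue measurable function is
   a.e. equal to a Borel one. *)
Definition Lvar := Quotient.quot Lvar_null.

HB.instance Definition _ := Choice.on Lvar.
HB.instance Definition _ := GRing.Zmodule.on Lvar.
HB.instance Definition _ := EqQuotient.on Lvar.

Definition Lvar_repr (f : Lvar) : Lvar_fun := repr f.

Local Open Scope quotient_scope.

Lemma Lvar_pi_eqP (f g : Lvar_fun) :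
  {ae mu, forall x, E x -> f x = g x} <-> \pi_Lvar f = \pi_Lvar g.
Proof.
split=> [fg|/eqP].
  apply/eqP; rewrite -Quotient.idealrBE; apply/asboolP.
  apply: filterS fg => x fg Ex.
  by rewrite LvarBE fg// subrr.
rewrite -Quotient.idealrBE => /asboolP fg.
apply: filterS fg => x + Ex => /(_ Ex) /eqP.
by rewrite LvarBE subr_eq0 => /eqP.
Qed.

Lemma Lvar_reprE (f : Lvar_fun) :
  {ae mu, forall x, E x -> Lvar_repr (\pi_Lvar f) x = f x}.
Proof. by apply/Lvar_pi_eqP; rewrite reprK. Qed.

Definition Lvar_scale (a : R) (f : Lvar) : Lvar := \pi_Lvar (a *: repr f).

Lemma pi_Lvar_scale a (f : Lvar_fun) :
  Lvar_scale a (\pi_Lvar f) = \pi_Lvar (a *: f).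
Proof.
apply/Lvar_pi_eqP; apply: filterS (Lvar_reprE f) => x + Ex => /(_ Ex) fx.
by rewrite !LvarZE -fx.
Qed.

Let LvarP (P : Lvar -> Prop) : (forall f, P (\pi_Lvar f)) -> forall f, P f.
Proof. by move=> Pf f; rewrite -[f]reprK. Qed.

Let piD (f g : Lvar_fun) : \pi_Lvar f + \pi_Lvar g = \pi_Lvar (f + g).
Proof. by rewrite !piE. Qed.

Let Lvar_scaleA a b v :
  Lvar_scale a (Lvar_scale b v) = Lvar_scale (a * b) v.
Proof. by elim/LvarP: v => f; rewrite !pi_Lvar_scale scalerA. Qed.

Let Lvar_scale1 : left_id 1 Lvar_scale.
Proof. by elim/LvarP => f; rewrite pi_Lvar_scale scale1r. Qed.

Let Lvar_scaleDr : right_distributive Lvar_scale +%R.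
Proof.
move=> a; elim/LvarP => f; elim/LvarP => g.
by rewrite piD !pi_Lvar_scale piD scalerDr.
Qed.

Let Lvar_scaleDl v : {morph Lvar_scale^~ v : a b / a + b}.
Proof. by move=> a b; elim/LvarP: v => f; rewrite !pi_Lvar_scale piD scalerDl. Qed.

HB.instance Definition _ := GRing.Zmodule_isLmodule.Build R Lvar
  Lvar_scaleA Lvar_scale1 Lvar_scaleDr Lvar_scaleDl.

Definition Lvar_norm (f : Lvar) : R := fine (luxemburg_norm p (repr f)).

Lemma luxemburg_norm_Lvar_fin (f : Lvar_fun) :
  luxemburg_norm p f \is a fin_num.
Proof.
rewrite ge0_fin_numE; last exact: luxemburg_norm_ge0.
exact: luxemburg_norm_lty (measurable_Lvar f) (modular_Lvar_lty f).
Qed.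

Lemma Lvar_norm_pi (f : Lvar_fun) :
  (Lvar_norm (\pi_Lvar f))%:E = luxemburg_norm p f.
Proof.
rewrite /Lvar_norm fineK; last exact: luxemburg_norm_Lvar_fin.
apply: luxemburg_norm_ae_eq; [exact: measurable_Lvar|exact: measurable_Lvar|].
exact: Lvar_reprE.
Qed.

Let norm_ge0 f : 0 <= Lvar_norm f.
Proof.
elim/LvarP: f => f; rewrite -lee_fin Lvar_norm_pi.
exact: luxemburg_norm_ge0.
Qed.

Let norm_lt (f : Lvar_fun) a : Lvar_norm (\pi_Lvar f) < a ->
  (modular p (fun x => (f x / a)%R) <= 1)%E.
Proof.
rewrite -lte_fin Lvar_norm_pi; apply: luxemburg_norm_lt.
exact: measurable_Lvar.
Qed.

Let norm_le (f : Lvar_fun) a : 0 < a ->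
  (modular p (fun x => (f x / a)%R) <= 1)%E -> Lvar_norm (\pi_Lvar f) <= a.
Proof.
by move=> a0 fa; rewrite -lee_fin Lvar_norm_pi; exact: luxemburg_norm_le.
Qed.

Let Lvar_ler_normD u v : Lvar_norm (u + v) <= Lvar_norm u + Lvar_norm v.
Proof.
elim/LvarP: u => f; elim/LvarP: v => g; rewrite piD.
apply/ler_addgt0Pr => e e0.
pose a := Lvar_norm (\pi_Lvar f) + e / 2.
pose b := Lvar_norm (\pi_Lvar g) + e / 2.
have a0 : 0 < a by rewrite ltr_wpDl// ?norm_ge0// divr_gt0.
have b0 : 0 < b by rewrite ltr_wpDl// ?norm_ge0// divr_gt0.
have fa : (modular p (fun x => (f x / a)%R) <= 1)%E.
  by apply: norm_lt; rewrite ltrDl divr_gt0.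
have gb : (modular p (fun x => (g x / b)%R) <= 1)%E.
  by apply: norm_lt; rewrite ltrDl divr_gt0.
have -> : Lvar_norm (\pi_Lvar f) + Lvar_norm (\pi_Lvar g) + e = a + b.
  by rewrite /a /b addrACA -splitr.
clearbody a b.
have ab0 : 0 < a + b by exact: addr_gt0.
apply: (norm_le ab0).
have t0 : 0 <= a / (a + b) by rewrite divr_ge0 ?ltW.
have t1 : a / (a + b) <= 1 by rewrite ler_pdivrMr// mul1r lerDl ltW.
have tE : 1 - a / (a + b) = b / (a + b).
  by rewrite -[X in X - _](@divff _ (a + b)) ?gt_eqF// -mulrBl addrAC subrr add0r.
have mfa : measurable_fun E (fun x => f x / a).
  under eq_fun do rewrite mulrC.
  by apply: measurable_funM => //; exact: measurable_Lvar.
have mgb : measurable_fun E (fun x => g x / b).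
  under eq_fun do rewrite mulrC.
  by apply: measurable_funM => //; exact: measurable_Lvar.
have fgE : (fun x => (f + g : Lvar_fun) x / (a + b)) =
    (fun x => a / (a + b) * (f x / a) + (1 - a / (a + b)) * (g x / b)).
  apply/funext => x; rewrite LvarDE tE.
  rewrite [a / _ * _]mulrACA [b / _ * _]mulrACA mulrDl.
  rewrite [a * f x]mulrC [b * g x]mulrC -!mulrA.
  rewrite [_^-1 * a^-1]mulrC [_^-1 * b^-1]mulrC.
  by rewrite (mulrA a) (mulrA b) !divff ?gt_eqF// !mul1r.
rewrite fgE; apply: (le_trans (modular_convex p mfa mgb t0 t1)).
apply: (@le_trans _ _ ((a / (a + b))%:E * 1 + (1 - a / (a + b))%:E * 1)%E).
  by apply: leeD; apply: lee_wpmul2l; rewrite ?lee_fin ?subr_ge0.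
by rewrite !mule1 -EFinD lee_fin addrC subrK.
Qed.

Let Lvar_normZ_le l v : Lvar_norm (l *: v) <= `|l| * Lvar_norm v.
Proof.
elim/LvarP: v => f; rewrite [l *: _]pi_Lvar_scale.
apply/ler_addgt0Pr => e e0.
pose a := Lvar_norm (\pi_Lvar f) + e / (`|l| + 1).
have l1 : 0 < `|l| + 1 by rewrite ltr_wpDl.
have a0 : 0 < a by rewrite ltr_wpDl// ?norm_ge0// divr_gt0.
have fa : (modular p (fun x => (f x / a)%R) <= 1)%E.
  by apply: norm_lt; rewrite ltrDl divr_gt0.
have la : `|l| * a <= `|l| * Lvar_norm (\pi_Lvar f) + e.
  rewrite mulrDr lerD2l mulrCA ger_pMr// ler_pdivrMr// mul1r.
  by rewrite lerDl.
have c0 : 0 < `|l| * Lvar_norm (\pi_Lvar f) + e.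
  by rewrite ltr_wpDl// mulr_ge0 ?norm_ge0.
apply: (norm_le c0); apply: (le_trans _ fa); apply: le_modular.
- under eq_fun do rewrite mulrC.
  by apply: measurable_funM => //; exact: measurable_Lvar.
- under eq_fun do rewrite mulrC.
  by apply: measurable_funM => //; exact: measurable_Lvar.
move=> x _; rewrite LvarZE !normrM !normfV.
rewrite (gtr0_norm c0) (gtr0_norm a0) ler_pdivrMr// mulrAC ler_pdivlMr//.
by rewrite [X in X <= _]mulrAC [X in X <= _]mulrC ler_wpM2l.
Qed.

Let Lvar_normrZ l v : Lvar_norm (l *: v) = `|l| * Lvar_norm v.
Proof.
have [->|l0] := eqVneq l 0.
  rewrite normr0 mul0r; apply/le_anti; rewrite norm_ge0 andbT.
  by rewrite (le_trans (Lvar_normZ_le _ _))// normr0 mul0r.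
apply/le_anti; rewrite Lvar_normZ_le/= -ler_pdivlMl ?normr_gt0//.
rewrite -normfV -[X in Lvar_norm X <= _]scale1r -(mulVf l0) -scalerA.
exact: Lvar_normZ_le.
Qed.

Let Lvar_normr0_eq0 v : Lvar_norm v = 0 -> v = 0.
Proof.
elim/LvarP: v => f f0.
have small k : 0 < k -> k <= 1 -> (modular p f <= k%:E)%E.
  move=> k0 k1.
  have fk : (modular p (fun x => (f x / k)%R) <= 1)%E by apply: norm_lt; rewrite f0.
  have mfk : measurable_fun E (fun x => f x / k).
    under eq_fun do rewrite mulrC.
    by apply: measurable_funM => //; exact: measurable_Lvar.
  have := modularZ_le p mfk (ltW k0) k1.
  have -> : (fun x => k * (f x / k)) = f.
    by apply/funext => x; rewrite mulrC divfK ?gt_eqF.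
  move=> /le_trans; apply; rewrite -[leRHS]mule1.
  by apply: lee_wpmul2l => //; rewrite lee_fin ltW.
have If0 : modular p f = 0%E.
  apply/le_anti; rewrite modular_ge0 andbT; apply/lee_addgt0Pr => e e0.
  rewrite add0e; apply: (@le_trans _ _ (Num.min e 1)%:E).
    by apply: small; rewrite ?lt_min ?e0 ?ltr01// ge_min lexx orbT.
  by rewrite lee_fin ge_min lexx.
have mf := measurable_modular p (measurable_Lvar f).
have mE := measurable_exponent_dom p.
have : (\int[mu]_(x in E) `|(`|f x| `^ p x)%:E| = 0)%E.
  rewrite -[RHS]If0; apply: eq_integral => x _.
  by rewrite gee0_abs// lee_fin powR_ge0.
move=> /(ae_eq_integral_abs mu mE mf) fae.
have -> : 0 = \pi_Lvar 0 by rewrite piE.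
apply/Lvar_pi_eqP; apply: filterS fae => x + Ex => /(_ Ex)[].
by move/powR_eq0_eq0/eqP; rewrite normr_eq0 => /eqP.
Qed.

HB.instance Definition _ := @Lmodule_isNormed.Build R Lvar
  Lvar_norm Lvar_ler_normD Lvar_normrZ Lvar_normr0_eq0.

End Lvar.
Coercion Lvar_repr : Lvar >-> Lvar_fun.

Lemma Lvar_normE (R : realType) n (E : set 'rV[R]_n) (p : bounded_exponent E)
    (f : Lvar p) : (`|f|%:E = luxemburg_norm p f)%E.
Proof. by rewrite -Lvar_norm_pi /Lvar_repr reprK. Qed.

Section regularity.
Variables (R : realType) (n : nat) (E : set 'rV[R]_n) (p : bounded_exponent E).

Definition wLip : Prop :=
  exists2 C : R, 0 < C & forall x y, E x -> E y ->
    0 < euclid_norm (x - y) <= 2^-1 ->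
    `|p x - p y| <= C / - ln (euclid_norm (x - y)).

(* When E is bounded, the limit condition holds for every value pinf. *)
Definition Pinfty : Prop :=
  exists pinf : R,
    (forall eps : R, 0 < eps -> exists M : R, forall x, E x ->
      M < euclid_norm x -> `|p x - pinf| < eps) /\
    (exists2 C : R, 0 < C & forall x, E x ->
      `|p x - pinf| <= C / ln (2 + euclid_norm x)).

End regularity.

Definition unit_ball_volume (R : realType) n : R :=
  fine (lebesgue_rV n (euclid_ball (0 : 'rV[R]_n) 1)).

(* f \_ E is f extended by point = 0 outside E. For a class f : Lvar p the
   coercion to functions picks a representative; the integral does not depend
   on it. *)
Definition steklov (R : realType) n (E : set 'rV[R]_n) (h : R)
    (f : 'rV[R]_n -> R) (x : 'rV[R]_n) : R :=
  (unit_ball_volume R n * h ^+ n)^-1 *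
    (\int[lebesgue_rV n]_(t in euclid_ball x h) (f \_ E) t)%R.

(* Main.v *)
(* Write [steklov h f] for the Steklov mean, [E] for the closure of [Omega].

   If the family is relatively compact, it has finite nets, so it suffices that
   [steklov h] is bounded on L^{p(.)}(E) uniformly in small [h], and that
   [steklov h f] tends to [f] for each [f]. The first fact comes from the
   log-Hoelder condition, which makes [h ^- |p x - p t|] bounded for
   [|x - t| < h]. The second one reduces by truncation to bounded [f], hence to
   L^1 convergence, hence to indicators of open sets by Dynkin's theorem.

   Conversely, let [steklov h f - f] tend to [0] uniformly. Some weight [w] has
   its mean over any ball of radius [h] centered in [E] bounded by [w - c],
   with [c > 0]; integrating [w |f|], this bounds the L^1 norm of [f] by that of
   [steklov h f - f]. So the family is bounded in L^1 and its means are uniformly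
   bounded for each [h]; they are also equicontinuous, since [f] is the sum
   of a bounded function [steklov k f] and a remainder that is small in L^1.
   The family is thus totally bounded, and L^{p(.)}(E) is complete. *)
From HB Require Import structures.
Require Import Defs.
From mathcomp Require Import all_boot all_order all_algebra.
From mathcomp Require Import all_classical all_reals all_analysis.
From mathcomp Require Import ring lra measurable_realfun.
From mathcomp Require finmap.
Import Order.TTheory GRing.Theory Num.Theory.
Import numFieldNormedType.Exports.
Local Open Scope classical_set_scope.
Local Open Scope ring_scope.

Set Implicit Arguments.
Unset Strict Implicit.
Unset Printing Implicit Defensive.

(** * The Euclidean norm *)

(** Three obstacles shape the argument. The exponent may come down to 1, and the maximal operator is
    unbounded already on L^1, so the bound on the means is a direct estimate, linear in the mean of
    [|f|^p]; the fact that averaging is a contraction of L^1 then controls this mean. The family is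
    not assumed bounded. Its bound comes from the extension by zero: averaging is self-adjoint and
    loses mass through the boundary of E. The weight measures this loss in the manner of a Lyapunov
    function; [M - exp (a x_1)] is the usual strictly superharmonic one, and it makes
    [1 - steklov h] bounded from below on L^1(E). This needs a direction in which to leave E, hence
    [0 < n]: in dimension 0 the space is a point of mass 1, every [f] equals its mean on E, and
    every family satisfies the condition, compact closure or not. Finally, the norm controls the L^1
    norm since E has finite measure, but the converse is available only under a common sup bound.
    Estimates are therefore made in L^1 or in sup norm, and brought back by truncation or for
    bounded functions only. *)

Section euclid_norm.
Context {R : realType} {n : nat}.
Implicit Types (x y z : 'rV[R]_n) (r : R).

Lemma euclid_norm_ge0 x : 0 <= euclid_norm x.
Proof. exact: sqrtr_ge0. Qed.

Lemma euclid_norm_sqr x : euclid_norm x ^+ 2 = \sum_(i < n) x ord0 i ^+ 2.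
Proof. by rewrite sqr_sqrtr// sumr_ge0// => i _; rewrite sqr_ge0. Qed.

Lemma euclid_normZ a x : euclid_norm (a *: x) = `|a| * euclid_norm x.
Proof.
rewrite /euclid_norm (eq_bigr (fun i => a ^+ 2 * x ord0 i ^+ 2)).
  by rewrite -mulr_sumr sqrtrM ?sqr_ge0// sqrtr_sqr.
by move=> i _; rewrite mxE exprMn.
Qed.

Lemma euclid_norm0 : euclid_norm (0 : 'rV[R]_n) = 0.
Proof. by rewrite -(scale0r 0) euclid_normZ normr0 mul0r. Qed.

Lemma euclid_normN x : euclid_norm (- x) = euclid_norm x.
Proof. by rewrite -scaleN1r euclid_normZ normrN1 mul1r. Qed.

Lemma euclid_normB x y : euclid_norm (x - y) = euclid_norm (y - x).
Proof. by rewrite -euclid_normN opprB. Qed.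

Lemma coord_le_euclid_norm x i : `|x ord0 i| <= euclid_norm x.
Proof.
rewrite -sqrtr_sqr ler_sqrt ?sumr_ge0// => [|j _]; last exact: sqr_ge0.
by rewrite (bigD1 i)//= lerDl sumr_ge0// => j _; rewrite sqr_ge0.
Qed.

Lemma euclid_norm_le_sum x : euclid_norm x <= \sum_(i < n) `|x ord0 i|.
Proof.
have s0 : 0 <= \sum_(i < n) `|x ord0 i| by exact: sumr_ge0.
rewrite -[leRHS]ger0_norm// -sqrtr_sqr ler_sqrt ?sqr_ge0//.
rewrite expr2 mulr_suml ler_sum// => i _.
rewrite -normr_id -real_normK ?num_real// expr2 normr_id ler_wpM2l//.
by rewrite (bigD1 i)//= lerDl sumr_ge0.
Qed.

(** The topology and [bounded_set] refer to the max norm; this comparison and [norm_le_euclid_norm]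
    carry them over to Euclidean balls. *)
Lemma euclid_norm_le_norm x : euclid_norm x <= n%:R * `|x|.
Proof.
apply: le_trans (euclid_norm_le_sum x) _.
rewrite mulr_natl -[X in _ *+ X]card_ord -sumr_const ler_sum// => i _.
by rewrite /Num.Def.normr/= mx_normrE;
  exact: (le_bigmax _ (fun i => `|x i.1 i.2|) (ord0, i)).
Qed.

Lemma norm_le_euclid_norm x : `|x| <= euclid_norm x.
Proof.
rewrite /Num.Def.normr/= mx_normrE; apply/bigmax_leP; split.
  exact: euclid_norm_ge0.
by move=> [i j] _ /=; rewrite ord1 coord_le_euclid_norm.
Qed.

Lemma euclid_norm_eq0 x : euclid_norm x = 0 -> x = 0.
Proof.
by move=> x0; apply/eqP; rewrite -normr_le0 -x0 norm_le_euclid_norm.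
Qed.

(** A weighted form of the square avoids Cauchy-Schwarz: coordinatewise,
    [(1 + b / a) u^2 + (1 + a / b) v^2] exceeds [(u + v)^2] by [(b u - a v)^2 / (a b)], and summing
    the left side gives exactly [(a + b)^2]. *)
Lemma euclid_normD x y : euclid_norm (x + y) <= euclid_norm x + euclid_norm y.
Proof.
set a := euclid_norm x; set b := euclid_norm y.
have [x0|x0] := eqVneq a 0.
  by rewrite x0 (euclid_norm_eq0 x0) !add0r.
have [y0|y0] := eqVneq b 0.
  by rewrite y0 (euclid_norm_eq0 y0) !addr0.
have a0 : 0 < a by rewrite lt_neqAle eq_sym x0 euclid_norm_ge0.
have b0 : 0 < b by rewrite lt_neqAle eq_sym y0 euclid_norm_ge0.
have ab0 : 0 <= a + b by rewrite addr_ge0// ltW.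
rewrite -[leRHS]ger0_norm// -sqrtr_sqr ler_sqrt ?sqr_ge0//.
have -> : (a + b) ^+ 2 = (1 + b / a) * a ^+ 2 + (1 + a / b) * b ^+ 2 by field;
  rewrite x0 y0.
have -> : a ^+ 2 = _ := euclid_norm_sqr x.
have -> : b ^+ 2 = _ := euclid_norm_sqr y.
rewrite !mulr_sumr -big_split/= ler_sum// => i _.
rewrite mxE -subr_ge0.
set u := x _ _; set v := y _ _.
have -> : (1 + b / a) * u ^+ 2 + (1 + a / b) * v ^+ 2 - (u + v) ^+ 2 =
  (b * u - a * v) ^+ 2 / (a * b) by field; rewrite x0 y0.
by rewrite divr_ge0 ?sqr_ge0// mulr_ge0// ltW.
Qed.

Lemma euclid_norm_distD z x y :
  euclid_norm (x - y) <= euclid_norm (x - z) + euclid_norm (z - y).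
Proof. by rewrite (le_trans _ (euclid_normD _ _))// addrA subrK. Qed.

Lemma euclid_ball_sym x y r : euclid_ball x r y -> euclid_ball y r x.
Proof. by rewrite /euclid_ball/= euclid_normB. Qed.

Lemma euclid_ball_center x r : 0 < r -> euclid_ball x r x.
Proof. by rewrite /euclid_ball/= subrr euclid_norm0. Qed.

Lemma euclid_ball_nbhs x (U : set 'rV[R]_n) :
  open U -> U x -> exists2 r, 0 < r & euclid_ball x r `<=` U.
Proof.
rewrite openE => /[apply]; rewrite /interior => /nbhs_ballP[/= e e0 eU].
exists e => // y xy; apply: eU; rewrite -ball_normE /ball_/=.
by rewrite distrC (le_lt_trans (norm_le_euclid_norm _)).
Qed.

Lemma open_euclid_ball x r : open (euclid_ball x r).
Proof.
rewrite openE => y xy; apply/nbhs_ballP.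
(* Dividing by [n.+1] instead of [n] keeps the radius meaningful for [n = 0]. *)
pose e := (r - euclid_norm (y - x)) / n.+1%:R.
have e0 : 0 < e by rewrite divr_gt0// subr_gt0.
exists e => //= z; rewrite -ball_normE /ball_/= => yz.
rewrite /euclid_ball/= (le_lt_trans (euclid_norm_distD y _ _))// -ltrBrDr.
rewrite euclid_normB (le_lt_trans (euclid_norm_le_norm _))//.
rewrite (@le_lt_trans _ _ (n.+1%:R * `|y - z|))//.
  by rewrite ler_wpM2r// ler_nat.
by rewrite -ltr_pdivlMl// mulrC.
Qed.

Lemma measurable_euclid_ball x r : measurable (euclid_ball x r).
Proof. by apply: open_measurable_mx; exact: open_euclid_ball. Qed.

Lemma le_euclid_ball x r s : r <= s -> euclid_ball x r `<=` euclid_ball x s.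
Proof. by move=> rs y yx; exact: lt_le_trans yx rs. Qed.

End euclid_norm.

(** * Affine changes of variables *)

Section lebesgue_affine.
Context {R : realType}.

(** Lebesgue measure is determined by its values on half-open intervals, and the pushforward scaled
    by [h^-1] takes the same values there. *)
Lemma lebesgue_measure_affine (a h : R) (A : set (measurableTypeR R)) :
  0 < h -> measurable A ->
  lebesgue_measure ((fun x : measurableTypeR R => h^-1 * (x - a)) @^-1` A) =
    (h%:E * lebesgue_measure A)%E.
Proof.
move=> h0 mA.
have mf : measurable_fun [set: measurableTypeR R] (fun x : measurableTypeR R => h^-1
  * (x - a) : measurableTypeR R).
  by apply: measurable_funM => //; apply: measurable_funB.
have hV0 : 0 <= h^-1 by rewrite invr_ge0 ltW.
pose nu := mscale (NngNum hV0)
  (measure_function_pushforward__canonical__measure_function_Measure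
     (@lebesgue_measure R) mf).
have nuE B : nu B = ((h^-1)%:E * lebesgue_measure ((fun x => (h^-1 * (x - a))%R)
  @^-1` B))%E by [].
suff -> : lebesgue_measure A = nu A.
  by rewrite nuE muleA -EFinM divff ?mul1e// gt_eqF.
apply: lebesgue_measure_unique => // X /ocitvP[->|[[u v]/= uv ->]];
  first by rewrite !measure0.
rewrite /=; apply/esym.
transitivity (nu `]u, v]%classic) => //.
rewrite nuE (_ : _ @^-1` _ = `]a + h * u, a + h * v]%classic); last first.
  apply/seteqP; split=> x /=; rewrite !in_itv/= ltr_pdivlMl// ler_pdivrMl//;
    by rewrite ltrBrDl lerBlDl.
rewrite !lebesgue_measure_itv/= !lte_fin ltrD2l ltr_pM2l//; case: ifPn => // _;
  last by rewrite mule0.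
by rewrite -!EFinD -EFinM; congr _%:E; field; rewrite gt_eqF.
Qed.

Lemma measurable_fun_affine_rV n (a : 'rV[R]_n) (h : R) :
  measurable_fun [set: 'rV[R]_n] (fun x : 'rV[R]_n => h^-1 *: (x - a)).
Proof.
apply: measurable_fun_mx => i j; under eq_fun do rewrite !mxE.
apply: measurable_funM => //; apply: measurable_funB => //.
exact: measurable_coord_mx.
Qed.

(** Induction on the dimension. The product measure is by definition the integral of the measures of
    the sections, so the last factor [h] comes from the one-dimensional case in each section and
    [h ^+ n] from the induction hypothesis on the outer integral. *)
Lemma lebesgue_rV_affine n (a : 'rV[R]_n) (h : R) (A : set 'rV[R]_n) :
  0 < h -> measurable A ->
  lebesgue_rV n ((fun x => h^-1 *: (x - a)) @^-1` A) = ((h ^+ n)%:E * lebesgue_rV n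
    A)%E.
Proof.
move=> h0; elim: n a A => [|n IH] a A mA.
  rewrite expr0 mul1e; congr (lebesgue_rV 0 _); apply/seteqP; split=> x /=;
  by rewrite [_ *: _](_ : _ = x)//; apply/rowP => -[].
have hn0 : 0 <= h ^+ n by rewrite exprn_ge0 // ltW.
pose A' := @cons_rV R n @^-1` A.
have mA' : measurable A'.
  by rewrite -[X in measurable X]setTI; exact: measurable_cons_rV.
pose a' := \row_(i < n) a ord0 (lift ord0 i).
pose phi (x : 'rV[R]_n) := h^-1 *: (x - a').
pose g x := lebesgue_measure (xsection A' x).
have g0 x : (0 <= g x)%E by rewrite /g; exact: (measure_ge0 (@lebesgue_measure R)).
have mg : measurable_fun setT g by exact: measurable_fun_xsection.
change (lebesgue_rV n.+1 A) with (\int[lebesgue_rV n]_x g x)%E.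
change (lebesgue_rV n.+1 ((fun x => h^-1 *: (x - a)) @^-1` A)) with
  (\int[lebesgue_rV n]_x lebesgue_measure (xsection (@cons_rV R n @^-1`
     ((fun x => (h^-1 *: (x - a))%R) @^-1` A)) x))%E.
have consE x t : cons_rV (phi x, h^-1 * (t - a ord0 ord0)) =
    h^-1 *: (cons_rV (x, t) - a).
  have affE (y : 'rV[R]_n.+1) i :
    (h^-1 *: (y - a)) ord0 i = h^-1 * (y ord0 i - a ord0 i) by rewrite !mxE.
  apply/rowP => i; rewrite affE; case: (unliftP ord0 i) => [j ->|->].
    by rewrite !cons_rV_lift !mxE.
  by rewrite !cons_rV_ord0.
transitivity (\int[lebesgue_rV n]_x (h%:E * (g \o phi) x))%E.
  apply: eq_integral => x _ /=.
  rewrite -(lebesgue_measure_affine (a ord0 ord0))//; last exact: measurable_xsection.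
  congr (lebesgue_measure _); apply/seteqP; split=> t;
    rewrite /xsection/= !inE/= /A'/=.
    by rewrite consE.
  by rewrite consE.
have mphi : measurable_fun setT phi by exact: measurable_fun_affine_rV.
rewrite ge0_integralZl//; last 2 first.
- exact: (measurableT_comp mg mphi).
- by rewrite lee_fin ltW.
rewrite -[X in integral _ X _](preimage_setT phi) -ge0_integral_pushforward//.
rewrite (eq_measure_integral (mscale (NngNum hn0) (lebesgue_rV n)))//; last first.
  by move=> B mB _; exact: IH.
rewrite ge0_integral_mscale//.
by rewrite muleA -EFinM exprS.
Qed.

End lebesgue_affine.

(** * Balls and Tonelli for ball averages *)

Section lebesgue_rV_ball.
Context {R : realType}.

Lemma measurable_rV_box n (A : 'I_n -> set (measurableTypeR R)) :
  (forall i, measurable (A i)) -> measurable [set x : 'rV[R]_n | forall i, A i (x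
    ord0 i)].
Proof.
move=> mA.
rewrite (_ : mkset _ = \bigcap_(i in [set: 'I_n]) ((fun x : 'rV[R]_n => x ord0 i)
  @^-1` A i)); last first.
  by apply/seteqP; split => x /= h i; [move=> _|]; exact: h.
apply: fin_bigcap_measurable => // i _; rewrite -[X in measurable X]setTI.
by apply: measurable_coord_mx => //; exact: mA.
Qed.

Lemma lebesgue_rV_ball_lty n (r : R) :
  (lebesgue_rV n (euclid_ball (0%R : 'rV[R]_n) r) < +oo)%E.
Proof.
pose A (i : 'I_n) : set (measurableTypeR R) := `[- r, r]%classic.
have mA i : measurable (A i) by exact: measurable_itv.
apply: (@le_lt_trans _ _ (lebesgue_rV n [set x | forall i, A i (x ord0 i)])).
  apply: le_measure; rewrite ?inE.
  - exact: measurable_euclid_ball.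
  - exact: measurable_rV_box.
  - move=> x; rewrite /euclid_ball/= subr0 => xr i; rewrite /A/= in_itv/= -ler_norml.
    by rewrite (le_trans (coord_le_euclid_norm _ _))// ltW.
rewrite lebesgue_rV_box//; suff /andP[] : (0 <= \prod_(i < n) lebesgue_measure (A i)
  < +oo)%E by [].
apply: (big_ind (fun x : \bar R => (0 <= x < +oo)%E)) => //.
- by rewrite lee01 ltry.
- move=> x y /andP[x0 xoo] /andP[y0 yoo]; rewrite mule_ge0//= lte_mul_pinfty//.
  by rewrite ge0_fin_numE.
- move=> i _; rewrite measure_ge0/= /A lebesgue_measure_itv/=; case: ifP => // _.
  by rewrite -EFinD ltry.
Qed.

Lemma lebesgue_rV_sigma_finite n : sigma_finite setT (lebesgue_rV (R := R) n).
Proof.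
exists (fun k => euclid_ball 0 k%:R).
  apply/esym; rewrite -subTset => x _.
  exists (Num.truncn (euclid_norm x)).+1 => //.
  rewrite /euclid_ball/= subr0 truncnS_gt//.
move=> k; split; [exact: measurable_euclid_ball|exact: lebesgue_rV_ball_lty].
Qed.

(* A copy of [lebesgue_rV] that carries the sigma-finite structure needed for
   Tonelli's theorem. *)
Definition lebesgue_rV_sf n : set 'rV[R]_n -> \bar R := lebesgue_rV n.
HB.instance Definition _ n := Measure.on (@lebesgue_rV_sf n).
HB.instance Definition _ n := Measure_isSigmaFinite.Build _ _ _
  (@lebesgue_rV_sf n) (@lebesgue_rV_sigma_finite n).

Lemma lebesgue_rV_open_gt0 n (U : set 'rV[R]_n) : open U -> U !=set0 ->
  (0 < lebesgue_rV n U)%E.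
Proof.
move=> oU [x Ux]; have : nbhs x U by exact: open_nbhs_nbhs.
move=> /nbhs_ballP[/= e e0 eU].
pose A (i : 'I_n) : set (measurableTypeR R) := `]x ord0 i - e, x ord0 i + e[%classic.
have mA i : measurable (A i) by exact: measurable_itv.
apply: (@lt_le_trans _ _ (lebesgue_rV n [set x | forall i, A i (x ord0 i)])).
  rewrite lebesgue_rV_box//.
  apply: (big_ind (fun x : \bar R => (0 < x)%E)) => //.
    by move=> ? ? ? ?; exact: mule_gt0.
  move=> i _; rewrite /A lebesgue_measure_itv/= lte_fin ifT; last by lra.
  by rewrite -EFinD lte_fin; lra.
apply: le_measure; rewrite ?inE.
- exact: measurable_rV_box.
- exact: open_measurable_mx.
- move=> y yA; apply: eU; split => // i j; rewrite ord1; have := yA j.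
  rewrite /A/= in_itv/= /ball/= => yj.
  by rewrite ltr_norml; apply/andP; split; lra.
Qed.

Lemma unit_ball_volumeE n :
  (lebesgue_rV n (euclid_ball (0%R : 'rV[R]_n) 1%R) = (unit_ball_volume R n)%:E)%E.
Proof. by rewrite fineK// ge0_fin_numE// lebesgue_rV_ball_lty. Qed.

Lemma unit_ball_volume_gt0 n : 0 < unit_ball_volume R n.
Proof.
rewrite -lte_fin -unit_ball_volumeE; apply: lebesgue_rV_open_gt0.
  exact: open_euclid_ball.
by exists 0; exact: euclid_ball_center.
Qed.

Lemma lebesgue_rV_ball n (x : 'rV[R]_n) (h : R) : 0 < h ->
  lebesgue_rV n (euclid_ball x h) = (unit_ball_volume R n * h ^+ n)%:E.
Proof.
move=> h0; rewrite mulrC EFinM -unit_ball_volumeE -(lebesgue_rV_affine x)//;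
  last first.
  exact: measurable_euclid_ball.
congr (lebesgue_rV n _); apply/seteqP; split=> y;
  rewrite /euclid_ball/= subr0 euclid_normZ gtr0_norm ?invr_gt0//.
  by rewrite ltr_pdivrMl// mulr1.
by rewrite ltr_pdivrMl// mulr1.
Qed.

Lemma ball_volume_gt0 n (h : R) : 0 < h -> 0 < unit_ball_volume R n * h ^+ n.
Proof. by move=> h0; rewrite mulr_gt0 ?unit_ball_volume_gt0 ?exprn_gt0. Qed.

Lemma lebesgue_rV_translate n (a : 'rV[R]_n) (A : set 'rV[R]_n) : measurable A ->
  lebesgue_rV n ((fun x => x - a) @^-1` A) = lebesgue_rV n A.
Proof.
move=> mA; have := lebesgue_rV_affine a ltr01 mA; rewrite expr1n mul1e => <-.
by congr (lebesgue_rV n _); apply/seteqP; split=> x /=; rewrite invr1 scale1r.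
Qed.

Lemma measurable_ball_graph n (h : R) :
  measurable [set z : 'rV[R]_n * 'rV[R]_n | euclid_ball z.1 h z.2].
Proof.
pose dif (z : 'rV[R]_n * 'rV[R]_n) := z.2 - z.1.
have mdif : measurable_fun setT dif.
  apply: measurable_fun_mx => i j; rewrite /dif; under eq_fun do rewrite !mxE.
  apply: measurable_funB.
    by apply: (measurableT_comp (f := fun M : 'rV[R]_n => M i j));
      [exact: measurable_coord_mx|exact: measurable_snd].
  by apply: (measurableT_comp (f := fun M : 'rV[R]_n => M i j));
    [exact: measurable_coord_mx|exact: measurable_fst].
have := mdif measurableT _ (measurable_euclid_ball (0 : 'rV[R]_n) h).
by rewrite setTI; congr measurable; apply/seteqP; split=> z;
  rewrite /euclid_ball/= subr0.
Qed.

Section tonelli.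
Variables (n : nat) (h : R) (phi g : 'rV[R]_n -> \bar R).
Hypotheses (mphi : measurable_fun setT phi) (mg : measurable_fun setT g).
Hypotheses (phi0 : forall x, (0 <= phi x)%E) (g0 : forall x, (0 <= g x)%E).
Local Open Scope ereal_scope.
Let mu : {measure set 'rV[R]_n -> \bar R} := lebesgue_rV n.

Let k (z : 'rV[R]_n * 'rV[R]_n) : \bar R :=
  (\1_[set z : 'rV[R]_n * 'rV[R]_n | euclid_ball z.1 h z.2] z)%:E.

Let mk : measurable_fun setT k.
Proof. by apply/measurable_EFinP; apply: measurable_indic;
  exact: measurable_ball_graph. Qed.

Let k0 z : 0 <= k z. Proof. by rewrite lee_fin. Qed.

Let kg x t : k (x, t) * g t = (g \_ (euclid_ball x h)) t.
Proof.
rewrite /k patchE indicE; case: (asboolP (euclid_ball x h t)) => xt.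
  by rewrite !mem_set// mul1e.
by rewrite !memNset// mul0e.
Qed.

Let mkg : measurable_fun setT (fun z => k z * g z.2).
Proof. by apply: emeasurable_funM => //; apply: measurableT_comp => //;
  exact: measurable_snd. Qed.

Let ball_int x : \int[mu]_t (k (x, t) * g t) = \int[mu]_(t in euclid_ball x h) g t.
Proof.
by rewrite [RHS]integral_mkcond; apply: eq_integral => t _; rewrite kg.
Qed.

Lemma measurable_ball_integral :
  measurable_fun setT (fun x => \int[mu]_(t in euclid_ball x h) g t).
Proof.
have := measurable_fun_fubini_tonelli_F (m2 := @lebesgue_rV_sf n) _ mkg (fun z =>
  mule_ge0 (k0 z) (g0 z.2)).
by congr (measurable_fun setT _); apply/funext => x; rewrite -ball_int.
Qed.

(** Averaging is self-adjoint because its kernel, the indicator of [|x - t| < h], is symmetric. *)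
Lemma ball_integral_tonelli :
  \int[mu]_x (phi x * \int[mu]_(t in euclid_ball x h) g t) =
  \int[mu]_t (g t * \int[mu]_(x in euclid_ball t h) phi x).
Proof.
have mf : measurable_fun setT (fun z : 'rV[R]_n * 'rV[R]_n => phi z.1 * (k z * g
  z.2)).
  by apply: emeasurable_funM => //; apply: measurableT_comp => //;
    exact: measurable_fst.
have f0 z : 0 <= phi z.1 * (k z * g z.2) by rewrite !mule_ge0.
have := fubini_tonelli (m1 := @lebesgue_rV_sf n) (m2 := @lebesgue_rV_sf n) _ mf f0.
rewrite [X in X = _ -> _](_ : _ = \int[mu]_x (phi x * \int[mu]_(t in euclid_ball x h)
  g t)); last first.
  apply: eq_integral => x _; rewrite -ball_int -ge0_integralZl//.
  - by apply: (measurableT_comp mkg); exact: pair1_measurable.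
  - by move=> t _; rewrite mule_ge0.
move=> ->; apply: eq_integral => t _.
rewrite [in RHS]integral_mkcond -ge0_integralZl//; last 2 first.
- have := (measurable_restrictT phi (measurable_euclid_ball t h)).1; apply;
  exact: measurable_funTS.
- by move=> x _; rewrite patchE; case: ifP.
apply: eq_integral => x _; rewrite [X in phi _ * X]muleC muleCA; congr (_ * _).
rewrite /k indicE patchE; case: (asboolP (euclid_ball x h t)) => xt.
  by rewrite !mem_set ?mul1e ?mule1//=; exact: euclid_ball_sym.
by rewrite !memNset ?mul0e ?mule0//= => /euclid_ball_sym.
Qed.

End tonelli.
End lebesgue_rV_ball.

(** * The Luxemburg norm *)

Section exponent_bound.
Context {R : realType} {n : nat} {E : set 'rV[R]_n}.

(** The decay condition bounds [p] at every point of E, through [ln 2 <= ln (2 + |x|)], whereas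
    [exponent_Linfty] does so only almost everywhere. *)
Lemma Pinfty_bounded (p : bounded_exponent E) : Pinfty p ->
  exists2 P : R, 1 <= P & forall x, E x -> p x <= P.
Proof.
move=> [pinf [_ [C C0 hC]]]; exists (1 + (`|pinf| + C / ln 2)).
  by rewrite lerDl addr_ge0// divr_ge0 ?ln_ge0 ?ler1n// ltW.
move=> x Ex; apply: (@le_trans _ _ (`|pinf| + C / ln 2)); last by rewrite lerDr.
rewrite -[p x](subrK pinf) addrC lerD ?ler_norm// (le_trans (ler_norm _))//.
rewrite (le_trans (hC x Ex))// ler_wpM2l ?(ltW C0)//.
have l2 : 0 < ln 2 :> R by rewrite ln_gt0// ltr1n.
have e0 := euclid_norm_ge0 x.
by rewrite lef_pV2 ?posrE ?ln_gt0 ?ler_ln ?posrE//; lra.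
Qed.

End exponent_bound.

Section luxemburg.
Context {R : realType} {n : nat} {E : set 'rV[R]_n} (p : bounded_exponent E).
Let mu : {measure set 'rV[R]_n -> \bar R} := lebesgue_rV n.
Let mE : measurable E := measurable_exponent_dom p.
Implicit Types f g : 'rV[R]_n -> R.

Lemma measurable_fun_mulr_cst (D : set 'rV[R]_n) (c : R) f : measurable_fun D f ->
  measurable_fun D (fun x => f x * c).
Proof. by move=> mf; apply: measurable_funM. Qed.

Lemma luxemburg_norm_fin_modular f (a : R) : measurable_fun E f ->
  (luxemburg_norm p f < a%:E)%E -> (modular p f < +oo)%E.
Proof.
move=> mf fa.
have := modularZ_lty a (measurable_fun_mulr_cst _ mf) (le_lt_trans (luxemburg_norm_lt
  mf fa) (ltry _)).
have a0 : 0 < a by rewrite -lte_fin (le_lt_trans (luxemburg_norm_ge0 p f)).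
by under eq_fun do rewrite mulrC divfK ?gt_eqF//.
Qed.

(** The triangle inequality of the quotient space, brought back to functions. The finite strict
    bounds are what makes [f] and [g] represent elements of the space. *)
Lemma luxemburg_normD_lt f g (a b : R) : measurable_fun E f -> measurable_fun E g ->
  (luxemburg_norm p f < a%:E)%E -> (luxemburg_norm p g < b%:E)%E ->
  (luxemburg_norm p (fun x => f x + g x)%R < (a + b)%:E)%E.
Proof.
move=> mf mg fa gb.
have If := luxemburg_norm_fin_modular mf fa.
have Ig := luxemburg_norm_fin_modular mg gb.
have fP : f \in Lvar_pred p by apply/asboolP.
have gP : g \in Lvar_pred p by apply/asboolP.
pose F := LvarFun fP; pose G := LvarFun gP.
have -> : (fun x => f x + g x) = (F + G : Lvar_fun p) by [].
have hF : Lvar_norm (\pi_(Lvar p)%qT F) < a by rewrite -lte_fin Lvar_norm_pi.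
have hG : Lvar_norm (\pi_(Lvar p)%qT G) < b by rewrite -lte_fin Lvar_norm_pi.
have FGE : \pi_(Lvar p)%qT F + \pi_(Lvar p)%qT G = \pi_(Lvar p)%qT (F + G) :> Lvar p.
  by rewrite !piE.
have := @ler_normD _ (Lvar p) (\pi_(Lvar p)%qT F) (\pi_(Lvar p)%qT G).
rewrite FGE => hFG; rewrite -(Lvar_norm_pi (F + G)) lte_fin.
exact: le_lt_trans hFG (ltrD hF hG).
Qed.

Lemma le_luxemburg_norm f g : measurable_fun E f -> measurable_fun E g ->
  (forall x, E x -> `|f x| <= `|g x|) -> (luxemburg_norm p f <= luxemburg_norm p g)%E.
Proof.
move=> mf mg fg; apply/ereal_infP => _ [l [l0 hl] <-].
apply: (luxemburg_norm_le l0); apply: (le_trans _ hl); apply: le_modular.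
- exact: measurable_fun_mulr_cst.
- exact: measurable_fun_mulr_cst.
- by move=> x Ex; rewrite !normrM ler_wpM2r// fg.
Qed.

Lemma luxemburg_normN f : measurable_fun E f ->
  luxemburg_norm p (fun x => - f x) = luxemburg_norm p f.
Proof.
move=> mf; have mNf : measurable_fun E (fun x => - f x) by exact: measurableT_comp.
apply: le_anti; apply/andP; split.
  by apply: (le_luxemburg_norm mNf mf) => x _; rewrite normrN.
by apply: (le_luxemburg_norm mf mNf) => x _; rewrite normrN.
Qed.

Hypothesis Efin : (mu E < +oo)%E.
Let mE0 : 0 <= fine (mu E). Proof. by rewrite fine_ge0// measure_ge0. Qed.
Let muE : mu E = (fine (mu E))%:E.
Proof. by rewrite fineK// ge0_fin_numE// measure_ge0. Qed.

Lemma ler_1DpowR (a q : R) : 0 <= a -> 1 <= q -> a <= 1 + a `^ q.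
Proof.
move=> a0 q1; have [a1|/ltW a1] := leP a 1;
  first by rewrite (le_trans a1)// lerDl powR_ge0.
by rewrite -[X in X <= _](powRr1 a0) (le_trans (ler_powR a1 q1))// lerDr.
Qed.

Lemma integral_le_modular f : measurable_fun E f ->
  (\int[mu]_(x in E) `|f x|%:E <= mu E + modular p f)%E.
Proof.
move=> mf.
have -> : (mu E + modular p f = \int[mu]_(x in E) (1 + (`|f x| `^ p x)%:E))%E.
  rewrite ge0_integralD//; last exact: measurable_modular.
  by rewrite integral_cst// mul1e.
apply: ge0_le_integral => //.
- by apply/measurable_EFinP; exact: measurableT_comp.
- by apply: emeasurable_funD => //; exact: measurable_modular.
- by move=> x Ex; rewrite -EFinD lee_fin ler_1DpowR// exponent_ge1.
Qed.

Lemma integral_le_luxemburg f (a : R) : measurable_fun E f ->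
  (luxemburg_norm p f < a%:E)%E ->
  (\int[mu]_(x in E) `|f x|%:E <= (a * (fine (mu E) + 1))%:E)%E.
Proof.
move=> mf fa; have a0 : 0 < a by rewrite -lte_fin (le_lt_trans (luxemburg_norm_ge0 p
  f)).
have h1 := luxemburg_norm_lt mf fa.
have := integral_le_modular (measurable_fun_mulr_cst a^-1 mf).
rewrite {1}muE => h2.
have -> : (\int[mu]_(x in E) `|f x|%:E = a%:E * \int[mu]_(x in E) `|f x / a|%:E)%E.
  rewrite -ge0_integralZl//; last 2 first.
  - by apply/measurable_EFinP; apply: measurableT_comp => //;
    exact: measurable_fun_mulr_cst.
  - by rewrite lee_fin ltW.
  apply: eq_integral => x _; rewrite -EFinM normrM normfV (gtr0_norm a0).
  by rewrite mulrC divfK// gt_eqF.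
rewrite EFinM; apply: lee_wpmul2l; first by rewrite lee_fin ltW.
by apply: (le_trans h2); rewrite EFinD; exact: leeD2l.
Qed.

Variable P : R.
Hypothesis pP : forall x, E x -> p x <= P.

(** Write [|g / l|^p] as [|g / l|^(p - 1) * |g / l|]: the sup bound turns the first factor into a
    constant, so the modular is at most a multiple of the L^1 norm. Taking [M'] at least 1 allows
    the exponent [p x - 1] to be replaced by [P]. *)
Lemma luxemburg_norm_small_L1 (M eps : R) : 0 < eps ->
  exists2 d : R, 0 < d & forall g, measurable_fun E g ->
    (forall x, E x -> `|g x| <= M) ->
    (\int[mu]_(x in E) `|g x|%:E <= d%:E)%E -> (luxemburg_norm p g < eps%:E)%E.
Proof.
move=> e0; pose l := eps / 2; have l0 : 0 < l by rewrite divr_gt0.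
pose M' := Num.max 1 (M / l).
have M1 : 1 <= M' by rewrite le_max lexx.
have MP : 0 < M' `^ P by rewrite powR_gt0//; lra.
exists (l / M' `^ P); first by rewrite divr_gt0.
move=> g mg gM gd; apply: (@le_lt_trans _ _ l%:E); last by rewrite lte_fin /l; lra.
apply: luxemburg_norm_le => //.
apply: (@le_trans _ _ (\int[mu]_(x in E) ((M' `^ P / l)%:E * `|g x|%:E))%E).
  apply: ge0_le_integral => //.
  - by apply: measurable_modular; exact: measurable_fun_mulr_cst.
  - by apply: emeasurable_funM => //; apply/measurable_EFinP; exact: measurableT_comp.
  move=> x Ex; rewrite -EFinM lee_fin.
  have p1 : 1 <= p x by exact: exponent_ge1.
  set a := `|g x / l|.
  have -> : M' `^ P / l * `|g x| = M' `^ P * a.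
    by rewrite /a normrM normfV (gtr0_norm l0) mulrAC mulrA.
  have [a0|a0] := eqVneq a 0; first by rewrite a0 mulr0 powR0// gt_eqF//; lra.
  have {}a0 : 0 < a by rewrite lt_neqAle eq_sym a0 normr_ge0.
  rewrite -[p x](subrK 1) powRD; last by rewrite (gt_eqF a0) implybT.
  rewrite powRr1 ?(ltW a0)// ler_wpM2r ?(ltW a0)//.
  apply: (@le_trans _ _ (M' `^ (p x - 1))).
    rewrite ge0_ler_powR ?nnegrE ?subr_ge0 ?(ltW a0)//; first lra.
    rewrite /M' le_max; apply/orP; right.
    by rewrite /a normrM normfV (gtr0_norm l0) ler_wpM2r ?invr_ge0 ?(ltW l0)// gM.
  by rewrite ler_powR//; have := pP Ex; lra.
rewrite ge0_integralZl//; last 2 first.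
- by apply/measurable_EFinP; exact: measurableT_comp.
- by rewrite lee_fin divr_ge0// ltW.
have c0 : (0 <= (M' `^ P / l)%:E)%E by rewrite lee_fin divr_ge0// ltW.
apply: (le_trans (lee_wpmul2l c0 gd)).
by rewrite -EFinM lee_fin -mulrA mulKf ?gt_eqF// divff ?gt_eqF.
Qed.

Lemma luxemburg_norm_small_sup (eps : R) : 0 < eps ->
  exists2 d : R, 0 < d & forall g, measurable_fun E g ->
    (forall x, E x -> `|g x| <= d) -> (luxemburg_norm p g < eps%:E)%E.
Proof.
move=> /(luxemburg_norm_small_L1 1)[d d0 H].
pose c := Num.min 1 (d / (fine (mu E) + 1)).
have m1 : 0 < fine (mu E) + 1 by rewrite ltr_wpDl.
have c0 : 0 < c by rewrite lt_min ltr01 divr_gt0.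
exists c => // g mg gc; apply: H => //.
  by move=> x /gc /le_trans; apply; rewrite ge_min lexx.
apply: (@le_trans _ _ (\int[mu]_(x in E) c%:E)%E).
  apply: ge0_le_integral => //.
  by apply/measurable_EFinP; exact: measurableT_comp.
rewrite integral_cst// muE -EFinM lee_fin.
apply: (@le_trans _ _ (d / (fine (mu E) + 1) * fine (mu E))).
  by rewrite ler_wpM2r// ge_min lexx orbT.
by rewrite mulrAC ler_pdivrMr// ler_wpM2l ?(ltW d0)// lerDl.
Qed.

End luxemburg.

(** * Total boundedness and completeness *)

Section totally_bounded.
Context {R : realType} {V : normedModType R}.

Lemma ultra_bigcup_seq (U : set_system V) (I : eqType) (s : seq I) (B : I -> set V) :
  UltraFilter U -> U [set x | exists2 i, i \in s & B i x] -> exists2 i, i \in s & U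
    (B i).
Proof.
move=> UU; elim: s => [|i s IH] Us.
  by exfalso; apply: (@filter_not_empty _ U); apply: filterS Us => x [].
have [UB|UB] := in_ultra_setVsetC (B i) UU; first by exists i => //; rewrite mem_head.
have [|j js UBj] := IH; last by exists j => //; rewrite in_cons js orbT.
apply: filterS2 UB Us => x Bx [j]; rewrite in_cons => /orP[/eqP ->//|js Bjx].
by exists j.
Qed.

(** An ultrafilter on the closure contains a ball of every radius [2^-(k+1)], and the centers of
    these balls form a sequence with geometric steps. Completeness is thus required only for such
    sequences, with an explicit rate. *)
Lemma totally_bounded_compact_closure (F : set V) :
  (forall u : nat -> V, (forall k, `|u k.+1 - u k| < 2^-1 ^+ k) ->
    exists l, forall m, `|l - u m| <= 2 * 2^-1 ^+ m) ->
  (forall e : R, 0 < e -> exists s : seq V, forall f, F f -> exists2 g, g \in s & `|f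
    - g| < e) ->
  compact (closure F).
Proof.
move=> cpl tb; rewrite compact_ultra => U UU UF.
have r0 k : 0 < 2^-1 ^+ k :> R by rewrite exprn_gt0.
have /choice[c Uc] : forall k, exists c, U [set x : V | `|x - c| < 2^-1 ^+ k.+1].
  (* Two errors [2^-(k+2)], one from a point of the closure to F and one from F to the net, make up
     the radius [2^-(k+1)]. *)
  move=> k; have [s sP] := tb _ (r0 k.+2).
  have [|g _ gU] := @ultra_bigcup_seq U _ s (fun g => [set x | `|x - g| < 2^-1 ^+
    k.+1]) UU; last by exists g.
  apply: filterS UF => x Fx.
  have [f [Ff xf]] := Fx _ (nbhsx_ballx x _ (r0 k.+2)).
  have [g gs fg] := sP _ Ff; exists g => //=.
  rewrite -ball_normE /ball_/= in xf.
  rewrite (le_lt_trans (ler_distD f _ _))// exprS.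
  by rewrite (_ : 2^-1 * 2^-1 ^+ k = 2^-1 ^+ k.+2 + 2^-1 ^+ k.+2) ?ltrD// !exprS; lra.
have [k|l lP] := cpl c.
  have [x [xk xk1]] := filter_ex (filterI (Uc k) (Uc k.+1)).
  rewrite (le_lt_trans (ler_distD x _ _))// distrC addrC.
  rewrite (lt_le_trans (ltrD xk xk1))// !exprS; have := r0 k; lra.
have Ul : U --> l.
  apply/cvg_ballP => e e0.
  have [k ke] : exists k, 3 * 2^-1 ^+ k < e.
    have : (3 * 2^-1 ^+ k @[k --> \oo] --> 3 * (0 : R)).
      by apply: cvgMr; apply: cvg_expr; rewrite ger0_norm ?invf_lt1 ?ltr1n.
    rewrite mulr0 => /cvgr0Pnorm_lt /(_ _ e0)[k _ /(_ k (leqnn k))/= h].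
    by exists k; rewrite (le_lt_trans (ler_norm _)).
  apply: filterS (Uc k) => x /= xc; rewrite -ball_normE /ball_/=.
  rewrite (le_lt_trans (ler_distD (c k) _ _))// (le_lt_trans _ ke)//.
  have {}xc : `|c k - x| <= 2^-1 ^+ k.+1 by rewrite distrC ltW.
  rewrite (le_trans (lerD (lP k) xc))// exprS.
  have := r0 k; lra.
exists l; split => //; rewrite [closure F](closure_id _).1;
  last exact: closed_closure.
by move=> B lB; exact: (filter_ex (filterI UF (Ul _ lB))).
Qed.

End totally_bounded.

Section powR.
Context {R : realType}.

Lemma continuous_norm_powR (q : R) : 0 < q -> continuous (fun a : R => `|a| `^ q).
Proof.
move=> q0 a; have [->|a0] := eqVneq a 0.
  rewrite /continuous_at normr0 powR0 ?gt_eqF//; apply/cvgr0Pnorm_lt => e e0.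
  have d0 : 0 < e `^ q^-1 by rewrite powR_gt0.
  near=> x; rewrite ger0_norm ?powR_ge0//.
  have -> : e = (e `^ q^-1) `^ q by rewrite -powRrM mulVf ?gt_eqF// powRr1 ?ltW.
  rewrite gt0_ltr_powR ?nnegrE ?(ltW d0)//.

have na0 : 0 < `|a| by rewrite normr_gt0.
have : {for a, continuous (fun x : R => expR (q * ln `|x|))}.
  apply: continuous_comp; last exact: continuous_expR.
  apply: continuousM; first exact: cst_continuous.
  apply: continuous_comp; [exact: norm_continuous|exact: continuous_ln].
rewrite /continuous_at /prop_for /=.
have -> : expR (q * ln `|a|) = `|a| `^ q by rewrite /powR gt_eqF.
apply: cvg_trans; apply: near_eq_cvg; near=> x; rewrite /powR gt_eqF// normr_gt0.
near: x; apply: (@cvgr_neq0 _ _ _ _ (nbhs_filter a) id a) => //; exact: cvg_id.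
Unshelve. all: by end_near. Qed.

End powR.

Section series_cvg.
Context {R : realType}.

Lemma cvgn_of_summable (u : nat -> R) :
  (\sum_(0 <= k <oo) `|u k.+1 - u k|%:E < +oo)%E -> cvgn u.
Proof.
move=> Su.
have S0 : (0 <= \sum_(0 <= k <oo) `|u k.+1 - u k|%:E)%E.
  by apply: nneseries_ge0 => k _ _; rewrite lee_fin.
have : cvgn (series (telescope u)).
  apply: normed_cvg; apply: nondecreasing_is_cvgn.
    apply/nondecreasing_seqP => k.
 rewrite [leRHS]big_nat_recr//= lerDl//.
  exists (fine (\sum_(0 <= k <oo) `|u k.+1 - u k|%:E)%E) => _ [k _ <-].
  rewrite -lee_fin fineK ?ge0_fin_numE// /series/= -sumEFin.
  by apply: nneseries_lim_ge => j _ _; rewrite lee_fin.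
move=> cu; have -> : u = (fun k => u 0%N + series (telescope u) k).
  by apply/funext => k; exact: eq_sum_telescope.
by apply: is_cvgD => //; exact: is_cvg_cst.
Qed.

End series_cvg.

(** * Completeness of the variable exponent space *)

Section Lvar_complete.
Context {R : realType} {n : nat} {E : set 'rV[R]_n} (p : bounded_exponent E).
Let mu : {measure set 'rV[R]_n -> \bar R} := lebesgue_rV n.
Let mE : measurable E := measurable_exponent_dom p.
Hypothesis Efin : (mu E < +oo)%E.

Lemma Lvar_distE (f g : Lvar p) :
  (`|f - g|%:E = luxemburg_norm p (fun x => f x - g x)%R)%E.
Proof.
pose F := Lvar_repr f; pose G := Lvar_repr g.
have fE : f = \pi_(Lvar p)%qT F by rewrite /F /Lvar_repr reprK.
have gE : g = \pi_(Lvar p)%qT G by rewrite /G /Lvar_repr reprK.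
have -> : f - g = \pi_(Lvar p)%qT (F - G) by rewrite fE gE !piE.
exact: (Lvar_norm_pi (F - G)).
Qed.

Lemma measurable_Lvar_sub (f g : Lvar p) : measurable_fun E (fun x => f x - g x).
Proof. by apply: measurable_funB; exact: measurable_Lvar. Qed.

(** The Riesz-Fischer argument. The increments are summable in L^1, which yields a limit almost
    everywhere; Fatou's lemma for the modular of [(u (k + m) - u m) / l] then gives the rate in the
    norm. *)
Lemma Lvar_fast_cauchy (u : nat -> Lvar p) :
  (forall k, `|u k.+1 - u k| < 2^-1 ^+ k) ->
  exists l, forall m, `|l - u m| <= 2 * 2^-1 ^+ m.
Proof.
move=> cu.
have r0 k : 0 < 2^-1 ^+ k :> R by rewrite exprn_gt0.
have um m k : `|u (k + m)%N - u m| < 2 * 2^-1 ^+ m.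
  (* The subtracted tail lets the induction close and leaves the strict inequality that
     [luxemburg_norm_lt] requires. *)
  suff : `|u (k + m)%N - u m| <= 2 * 2^-1 ^+ m - 2 * 2^-1 ^+ (k + m).
    by move=> /le_lt_trans; apply; have := r0 (k + m)%N; lra.
  elim: k => [|k IH]; first by rewrite add0n !subrr normr0.
  rewrite (le_trans (ler_distD (u (k + m)%N) _ _))// addSn exprS.
  rewrite (le_trans (lerD (ltW (cu _)) IH))//; lra.
pose d k x := `|u k.+1 x - u k x|.
pose c := fine (mu E) + 1.
have c0 : 0 <= c by rewrite addr_ge0// fine_ge0// measure_ge0.
have md k : measurable_fun E (fun x => (d k x)%:E).
  by apply/measurable_EFinP; apply: measurableT_comp => //;
    exact: measurable_Lvar_sub.
have d0 k x : E x -> (0 <= (d k x)%:E)%E by move=> _; rewrite lee_fin normr_ge0.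
have dle k : (\int[mu]_(x in E) (d k x)%:E <= (2^-1 ^+ k * c)%:E)%E.
  apply: (@integral_le_luxemburg _ _ _ p) => //; first exact: measurable_Lvar_sub.
  by rewrite -Lvar_distE lte_fin.
have Soo : (\int[mu]_(x in E) (\sum_(0 <= k <oo) (d k x)%:E) < +oo)%E.
  rewrite integral_nneseries//; apply: (@le_lt_trans _ _ (2 * c)%:E);
    last exact: ltry.
  apply: lime_le.
    by apply: is_cvg_nneseries => k _ _; apply: integral_ge0 => x; exact: d0.
  apply: nearW => N; apply: (@le_trans _ _ (\sum_(0 <= k < N) (2^-1 ^+ k * c)%:E)%E).
    by apply: lee_sum => k _; exact: dle.
  rewrite sumEFin lee_fin -mulr_suml ler_wpM2r//.
  suff -> : \sum_(0 <= k < N) 2^-1 ^+ k = 2 - 2 * 2^-1 ^+ N :> R.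
    by have := r0 N; lra.
  elim: N => [|N IH]; first by rewrite big_geq// expr0; lra.
  rewrite big_nat_recr//= IH exprS; lra.
pose S x := (\sum_(0 <= k <oo) (d k x)%:E)%E.
have mS : measurable_fun E S.
  rewrite /S; apply: (@ge0_emeasurable_sum _ _ R E (fun k x => (d k x)%:E) xpredT) =>
    //.
  by move=> k x Ex _; exact: d0.
have S0 x : E x -> (0 <= S x)%E by move=> Ex; apply: nneseries_ge0 => k _ _;
  exact: d0.
have iS : mu.-integrable E S.
  apply/integrableP; split => //; rewrite (eq_integral S)// => x /[!inE] Ex.
  by rewrite gee0_abs ?S0.
have cvgu : {ae mu, forall x, E x -> cvgn (fun k => u k x : R)}.
  apply: filterS (integrable_ae mE iS) => x + Ex => /(_ Ex) Sx.
  by apply: cvgn_of_summable; rewrite -/(S x) -ge0_fin_numE// S0.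
(* The upper limit exists at every point, so [v] is measurable on all of E, even where the sequence
   diverges. *)
pose v x := fine (limn_esup (fun k => (u k x)%:E)).
have vE : {ae mu, forall x, E x -> (fun k => u k x : R) @ \oo --> v x}.
  apply: filterS cvgu => x + Ex => /(_ Ex) ux.
  suff -> : v x = limn (fun k => u k x : R) by [].
  have : (fun k => (u k x)%:E) @ \oo --> (limn (fun k => u k x : R))%:E.
    by apply: cvg_EFin => //; exact: nearW.
  by rewrite /v => /cvg_limn_einf_sup[_ ->].
have mv : measurable_fun E v.
  apply: measurableT_comp => //; apply: measurable_fun_limn_esup => k.
  by apply/measurable_EFinP; exact: measurable_Lvar.
have mvu m : measurable_fun E (fun x => v x - u m x).
  by apply: measurable_funB => //; exact: measurable_Lvar.
have vu m : (luxemburg_norm p (fun x => v x - u m x)%R <= (2 * 2^-1 ^+ m)%:E)%E.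
  have l0 : 0 < 2 * 2^-1 ^+ m :> R by rewrite mulr_gt0.
  set l := 2 * 2^-1 ^+ m; apply: (luxemburg_norm_le l0).
  pose F k x := (`|(u (k + m)%N x - u m x) / l| `^ p x)%:E.
  have mF k : measurable_fun E (F k).
    by apply: measurable_modular; apply: measurable_fun_mulr_cst;
      exact: measurable_Lvar_sub.
  apply: (@le_trans _ _ (\int[mu]_(x in E) limn_einf (F^~ x))%E).
    apply: ae_ge0_le_integral => //.
    - by apply: measurable_modular; exact: measurable_fun_mulr_cst.
    - move=> x Ex; rewrite limn_einf_lim; apply: lime_ge; first exact: is_cvg_einfs.
      by apply: nearW => k; apply/ereal_infP => _ [j _ <-]; rewrite lee_fin powR_ge0.
    - apply: measurableT_comp => //; apply: measurable_fun_limn_esup => k.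
      exact: measurableT_comp.
    apply: filterS vE => x + Ex => /(_ Ex) ux.
    suff h : F^~ x @ \oo --> (`|(v x - u m x) / l| `^ p x)%:E.
      by rewrite (cvg_limn_einf_sup h).1.
    apply: cvg_EFin; first exact: nearW.
    have px : 0 < p x by rewrite (lt_le_trans ltr01)// exponent_ge1.
    apply: (cvg_comp (fun k => (u (k + m)%N x - u m x) / l)
      (fun a : R => `|a| `^ p x)); last exact: (continuous_norm_powR px).
    apply: cvgMl; apply: cvgB; last exact: cvg_cst.
    by apply: (cvg_comp (fun k => (k + m)%N) (fun k => u k x : R));
      [exact: cvg_addnr|exact: ux].
  have F0 k x : E x -> (0 <= F k x)%E by move=> _; rewrite lee_fin powR_ge0.
  apply: (le_trans (fatou mu mE mF F0)).
  rewrite limn_einf_lim; apply: lime_le; first exact: is_cvg_einfs.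
  apply: nearW => k; apply: (@le_trans _ _ (\int[mu]_(x in E) F k x)%E).
    by apply: ereal_inf_lbound; exists k => /=.
  apply: (luxemburg_norm_lt (measurable_Lvar_sub _ _)).
  by rewrite -Lvar_distE lte_fin.
have vfin : v \in Lvar_pred p.
  apply/asboolP; split => //.
  have h0 : (luxemburg_norm p (fun x => v x - u 0%N x)%R < 3%:E)%E.
    by apply: (le_lt_trans (vu _)); rewrite lte_fin expr0; lra.
  have h1 : (luxemburg_norm p (u 0%N) < (`|u 0%N| + 1)%:E)%E.
    by rewrite -Lvar_normE lte_fin ltrDl.
  have := luxemburg_normD_lt (mvu 0%N) (measurable_Lvar _) h0 h1.
  under eq_fun do rewrite subrK.
  exact: luxemburg_norm_fin_modular.
pose V := LvarFun vfin.
exists (\pi_(Lvar p)%qT V) => m; rewrite -lee_fin.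
have mE' : u m = \pi_(Lvar p)%qT (Lvar_repr (u m)) by rewrite /Lvar_repr reprK.
have -> : \pi_(Lvar p)%qT V - u m = \pi_(Lvar p)%qT (V - Lvar_repr (u m)).
  by rewrite {1}mE' !piE.
rewrite [X in (X <= _)%E](Lvar_norm_pi (V - Lvar_repr (u m))); exact: vu.
Qed.

End Lvar_complete.

(** * Means over balls *)

Section ball_mean.
Context {R : realType} {n : nat}.
Let mu : {measure set 'rV[R]_n -> \bar R} := lebesgue_rV n.
Implicit Types (g : 'rV[R]_n -> R) (h : R) (x : 'rV[R]_n).

Definition ball_mean h g x : R :=
  (unit_ball_volume R n * h ^+ n)^-1 * (\int[mu]_(t in euclid_ball x h) g t)%R.

Lemma steklovE (E : set 'rV[R]_n) h g : steklov E h g = ball_mean h (g \_ E).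
Proof. by []. Qed.

Local Notation L1 g := (mu.-integrable setT (EFin \o g)).

Lemma measurable_L1 g : L1 g -> measurable_fun setT g.
Proof. by move=> ig; apply/measurable_EFinP; exact: measurable_int ig. Qed.

Lemma ball_volumeV_gt0 h : 0 < h -> 0 < (unit_ball_volume R n * h ^+ n)^-1.
Proof. by move=> h0; rewrite invr_gt0 ball_volume_gt0. Qed.

Lemma integrable_ball h g x : L1 g -> mu.-integrable (euclid_ball x h) (EFin \o g).
Proof. by apply: integrableS => //; exact: measurable_euclid_ball. Qed.

Lemma ball_meanB h g1 g2 x : L1 g1 -> L1 g2 ->
  ball_mean h (fun t => g1 t - g2 t) x = ball_mean h g1 x - ball_mean h g2 x.
Proof.
move=> i1 i2; rewrite /ball_mean RintegralB ?mulrBr//.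
- exact: measurable_euclid_ball.
- exact: integrable_ball.
- exact: integrable_ball.
Qed.

Lemma ball_meanD h g1 g2 x : L1 g1 -> L1 g2 ->
  ball_mean h (fun t => g1 t + g2 t) x = ball_mean h g1 x + ball_mean h g2 x.
Proof.
move=> i1 i2; rewrite /ball_mean RintegralD ?mulrDr//.
- exact: measurable_euclid_ball.
- exact: integrable_ball.
- exact: integrable_ball.
Qed.

Lemma ball_meanZ h a g x : L1 g ->
  ball_mean h (fun t => a * g t) x = a * ball_mean h g x.
Proof.
move=> i1; rewrite /ball_mean RintegralZl//; first by rewrite mulrCA.
- exact: measurable_euclid_ball.
- exact: integrable_ball.
Qed.

Lemma measurable_ball_mean h g : measurable_fun setT g -> measurable_fun setT
  (ball_mean h g).
Proof.
move=> mg; have mg' : measurable_fun setT (EFin \o g) by exact/measurable_EFinP.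
apply: measurable_funM => //; rewrite /Rintegral; apply: measurableT_comp => //.
under eq_fun do rewrite integralE.
apply: emeasurable_funB; apply: measurable_ball_integral => //.
- exact: measurable_funepos.
- exact: measurable_funeneg.
Qed.

Lemma ball_mean_norm_le h g x : 0 < h -> L1 g ->
  (`|ball_mean h g x|%:E <= ((unit_ball_volume R n * h ^+ n)^-1)%:E *
    \int[mu]_(t in euclid_ball x h) `|g t|%:E)%E.
Proof.
move=> h0 ig; have v0 := ball_volumeV_gt0 h0.
rewrite /ball_mean normrM (gtr0_norm v0) EFinM; apply: lee_wpmul2l;
  first by rewrite lee_fin ltW.
have ib := integrable_ball h x ig.
rewrite (EFin_normr_Rintegral (measurable_euclid_ball _ _) ib).
apply: le_abse_integral; first exact: measurable_euclid_ball.
exact: measurable_int ib.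
Qed.

Lemma ball_mean_norm_le_L1 h g x (c : R) : 0 < h -> L1 g ->
  (\int[mu]_t `|g t|%:E <= c%:E)%E ->
  `|ball_mean h g x| <= (unit_ball_volume R n * h ^+ n)^-1 * c.
Proof.
move=> h0 ig gc; rewrite -lee_fin (le_trans (ball_mean_norm_le x h0 ig))// EFinM.
apply: lee_wpmul2l; first by rewrite lee_fin ltW// ball_volumeV_gt0.
apply: le_trans gc; apply: ge0_subset_integral => //.
- exact: measurable_euclid_ball.
- by apply/measurable_EFinP; apply: measurableT_comp => //; exact: measurable_L1 ig.
Qed.

(** Self-adjointness replaces the weight by its own mean. With [phi = 1] this is the contraction of
    L^1; with the weight of [exists_weight], cut to E, it is the source of the L^1 bound. *)
Lemma ball_mean_weight h g (phi : 'rV[R]_n -> \bar R) : 0 < h -> L1 g ->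
  measurable_fun setT phi -> (forall x, 0 <= phi x)%E ->
  (\int[mu]_x (phi x * `|ball_mean h g x|%:E) <=
   ((unit_ball_volume R n * h ^+ n)^-1)%:E *
     \int[mu]_t (`|g t|%:E * \int[mu]_(x in euclid_ball t h) phi x))%E.
Proof.
move=> h0 ig mphi phi0; set w := (_^-1)%:E.
have w0 : (0 <= w)%E by rewrite lee_fin ltW// ball_volumeV_gt0.
have mg : measurable_fun setT g by exact: measurable_L1 ig.
have mng : measurable_fun setT (fun t => `|g t|%:E).
  by apply/measurable_EFinP; exact: measurableT_comp.
rewrite -ball_integral_tonelli// -ge0_integralZl//; last 2 first.
- apply: emeasurable_funM => //; exact: measurable_ball_integral.
- by move=> x _; rewrite mule_ge0// integral_ge0.
apply: ge0_le_integral => //.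
- by move=> x _; rewrite mule_ge0.
- apply: emeasurable_funM => //; apply/measurable_EFinP;
  apply: measurableT_comp => //.
  exact: measurable_ball_mean.
- apply: emeasurable_funM => //; apply: emeasurable_funM => //.
  exact: measurable_ball_integral.
- move=> x _; rewrite muleCA; apply: lee_wpmul2l => //; exact: ball_mean_norm_le.
Qed.

Lemma ball_mean_L1 h g : 0 < h -> L1 g ->
  (\int[mu]_x `|ball_mean h g x|%:E <= \int[mu]_t `|g t|%:E)%E.
Proof.
move=> h0 ig.
have mg : measurable_fun setT g by exact: measurable_L1 ig.
have mng : measurable_fun setT (fun t => `|g t|%:E).
  by apply/measurable_EFinP; exact: measurableT_comp.
have := @ball_mean_weight h g (cst 1%E) h0 ig (measurable_cst _) (fun=> lee01).
under eq_integral do rewrite mul1e.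
move=> /le_trans; apply.
have -> : (\int[mu]_t (`|g t|%:E * \int[mu]_(x in euclid_ball t h) cst 1 x) =
  (unit_ball_volume R n * h ^+ n)%:E * \int[mu]_t `|g t|%:E)%E.
  rewrite -ge0_integralZl//; last by rewrite lee_fin ltW// ball_volume_gt0.
  apply: eq_integral => t _; rewrite integral_cst ?mul1e;
    last exact: measurable_euclid_ball.
  by rewrite [mu _]lebesgue_rV_ball// muleC.
by rewrite muleA -EFinM mulVf ?mul1e// gt_eqF// ball_volume_gt0.
Qed.

Lemma integrable_ball_mean h g : 0 < h -> L1 g -> L1 (ball_mean h g).
Proof.
move=> h0 ig; have mg : measurable_fun setT g by exact: measurable_L1 ig.
apply/integrableP; split; first by apply/measurable_EFinP;
  exact: measurable_ball_mean.
by apply: (le_lt_trans (ball_mean_L1 h0 ig)); have /integrableP[] := ig.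
Qed.

End ball_mean.

(** * The log-Hoelder bound *)

Section patch.
Context {R : realType} {n : nat} (E : set 'rV[R]_n) (mE : measurable E).
Let mu : {measure set 'rV[R]_n -> \bar R} := lebesgue_rV n.
Implicit Types f : 'rV[R]_n -> R.

Lemma patch_norm f x : `|(f \_ E) x| = ((fun t => `|f t|) \_ E) x.
Proof. by rewrite !patchE; case: ifP => // _; rewrite normr0. Qed.

Lemma integral_patch_norm f :
  (\int[mu]_x `|(f \_ E) x|%:E = \int[mu]_(x in E) `|f x|%:E)%E.
Proof.
rewrite [RHS]integral_mkcond; apply: eq_integral => x _.
by rewrite patch_norm !patchE; case: ifP.
Qed.

Lemma integrable_patch f : measurable_fun E f ->
  (\int[mu]_(x in E) `|f x|%:E < +oo)%E -> mu.-integrable setT (EFin \o (f \_ E)).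
Proof.
move=> mf foo; rewrite -restrict_EFin; apply/(integrable_mkcond _ mE).
by apply/integrableP; split => //; exact/measurable_EFinP.
Qed.

End patch.

Section log_hoelder.
Context {R : realType} {n : nat} {E : set 'rV[R]_n} (p : bounded_exponent E).
Let mu : {measure set 'rV[R]_n -> \bar R} := lebesgue_rV n.
Let mE : measurable E := measurable_exponent_dom p.
Hypothesis Efin : (mu E < +oo)%E.
Variable P : R.
Hypothesis P1 : 1 <= P.
Hypothesis pP : forall x, E x -> p x <= P.
Implicit Types f : 'rV[R]_n -> R.

Let vol := unit_ball_volume R n.
Let vol0 : 0 < vol. Proof. exact: unit_ball_volume_gt0. Qed.

(** [C / - ln r] increases with [r] on []0, 1[], so its value at [h] serves for all closer pairs.
    The case [x = t] is apart since the condition concerns positive distances. *)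
Lemma wLip_ball (C h : R) : 0 < C -> (forall x y, E x -> E y ->
    0 < euclid_norm (x - y) <= 2^-1 -> `|p x - p y| <= C / - ln (euclid_norm (x -
      y))) ->
  0 < h <= 2^-1 -> forall x t, E x -> E t -> euclid_ball x h t ->
  `|p x - p t| <= C / - ln h.
Proof.
move=> C0 pLip /andP[h0 h1] x t Ex Et xt.
have lnh : 0 < - ln h by rewrite oppr_gt0 ln_lt0// h0/=; lra.
have [->|xt0] := eqVneq x t; first by rewrite subrr normr0 divr_ge0// ltW.
have e0 : 0 < euclid_norm (x - t).
  rewrite lt_neqAle euclid_norm_ge0 andbT eq_sym;
    apply: contra xt0 => /eqP/euclid_norm_eq0/eqP.
  by rewrite subr_eq0.
have eh : euclid_norm (x - t) < h by rewrite euclid_normB.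
apply: (le_trans (pLip _ _ Ex Et _)).
  by rewrite e0/= (le_trans (ltW eh)).
rewrite ler_wpM2l ?(ltW C0)// lef_pV2 ?posrE//; last first.
  by rewrite oppr_gt0 ln_lt0// e0/=; lra.
by rewrite lerN2 ler_ln ?posrE// ltW.
Qed.

(** The point of the logarithmic modulus: [h^-n] raised to [C / - ln h] is [exp (C n)], whatever
    [h]. The remaining base [1 + vol^-1] has its exponent bounded by [C / ln 2], because
    [h <= 1/2]. *)
Lemma volume_power_bound (C h H : R) : 0 < C -> 0 < h <= 2^-1 ->
  1 <= H -> H <= 1 + (vol * h ^+ n)^-1 ->
  H `^ (C / - ln h) <= (1 + vol^-1) `^ (C / ln 2) * expR (C * n%:R).
Proof.
move=> C0 /andP[h0 h1] H1 Hh; set d := C / - ln h.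
have l2 : 0 < ln 2 :> R by rewrite ln_gt0// ltr1n.
have lnh2 : ln 2 <= - ln h.
  by rewrite -lnV ?posrE// ler_ln ?posrE ?invr_gt0// -[leLHS]invrK lef_pV2 ?posrE.
have lnh : 0 < - ln h by lra.
have d0 : 0 <= d by rewrite divr_ge0// ltW.
have hn0 : 0 < h ^- n by rewrite invr_gt0 exprn_gt0.
have vV : 0 < vol^-1 by rewrite invr_gt0.
apply: (@le_trans _ _ (((1 + vol^-1) * h ^- n) `^ d)).
  rewrite ge0_ler_powR ?nnegrE//; [lra|by rewrite mulr_ge0 ?ltW//; lra|].
  rewrite (le_trans Hh)// mulrDl mul1r invfM lerD2r.
  by rewrite invf_ge1 ?exprn_gt0// exprn_ile1//; lra.
rewrite powRM; [|lra|exact: ltW].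
apply: ler_pM; rewrite ?powR_ge0//.
  rewrite ler_powR//; first lra.
  by rewrite /d ler_wpM2l ?(ltW C0)// lef_pV2 ?posrE.
rewrite /powR gt_eqF// ler_expR lnV ?posrE ?exprn_gt0// lnXn// -[_ *- n]mulNrn -[_ *+
  n]mulr_natr.
rewrite (_ : d * (- ln h * n%:R) = C * n%:R)// /d; field.
by rewrite lt_eqF// -oppr_gt0.
Qed.

(** A substitute for Young's inequality that survives [q = 1]. If [a > s], then
    [a = a^(1-q) a^q <= s^(1-q) a^q], and replacing [q] by [r] in the power of [s] costs at most
    [s^d <= K]. With [q = p t] and [r = p x] the coefficient of [a^q] no longer depends on [t]. *)
Lemma young_split (a s q r d K : R) : 0 <= a -> 1 <= s -> 1 <= q -> `|r - q| <= d ->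
  s `^ d <= K -> a <= s + K * s `^ (1 - r) * a `^ q.
Proof.
move=> a0 s1 q1 rq sK; have s0 : 0 < s by lra.
have K0 : 0 <= K by rewrite (le_trans _ sK)// powR_ge0.
have [as_|/ltW sa] := leP a s.
  by rewrite (le_trans as_)// lerDl !mulr_ge0// powR_ge0.
have a1 : 0 < a by lra.
apply: (@le_trans _ _ (s `^ (1 - q) * a `^ q)).
  have {1}-> : a = a `^ (1 - q) * a `^ q.
    by rewrite -powRD ?(gt_eqF a1) ?implybT// subrK powRr1.
  rewrite ler_wpM2r ?powR_ge0//.
  have -> : 1 - q = - (q - 1) by lra.
  rewrite !powRN lef_pV2 ?posrE ?powR_gt0//.
  by rewrite ge0_ler_powR ?nnegrE//; lra.
apply: (@le_trans _ _ (K * s `^ (1 - r) * a `^ q)); last by rewrite lerDr ltW.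
rewrite ler_wpM2r ?powR_ge0//.
have -> : 1 - q = (r - q) + (1 - r) by lra.
rewrite powRD ?(gt_eqF s0) ?implybT// ler_wpM2r ?powR_ge0//.
rewrite (le_trans _ sK)// ler_powR// (le_trans _ rq)// ler_norm//.
Qed.

Let G f := (fun t => `|f t| `^ p t) \_ E.

Let intG f : measurable_fun E f -> (modular p f <= 1)%E ->
  mu.-integrable setT (EFin \o G f) /\ (\int[mu]_t `|G f t|%:E <= 1%:E)%E.
Proof.
move=> mf f1.
have GE : (\int[mu]_t `|G f t|%:E = modular p f)%E.
  rewrite integral_patch_norm; apply: eq_integral => x _.
  by rewrite ger0_norm// powR_ge0.
split; last by rewrite GE.
apply: integrable_patch => //; first by apply/measurable_EFinP;
  exact: measurable_modular.
by rewrite -integral_patch_norm GE (le_lt_trans f1)// ltry.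
Qed.

(* Let [H] be 1 plus the mean of [|f|^p] and [s = H ^ (1 / p x)]. Averaging
   [young_split] over the ball bounds the mean of [|f|] by a multiple of [s]. *)
Lemma steklov_modular_bound : wLip p -> exists2 K : R, 1 <= K &
  forall h f, 0 < h <= 2^-1 -> measurable_fun E f -> (modular p f <= 1)%E ->
    (modular p (steklov E h f) <= K%:E)%E.
Proof.
move=> [C C0 pLip].
pose K1 := (1 + vol^-1) `^ (C / ln 2) * expR (C * n%:R).
have vV : 0 < vol^-1 by rewrite invr_gt0.
have K10 : 0 <= K1 by rewrite mulr_ge0 ?powR_ge0 ?expR_ge0.
have K1P : 1 <= (1 + K1) `^ P.
  by rewrite -[leLHS](powRr0 (1 + K1)) ler_powR ?lerDl// (le_trans ler01 P1).
have mE0 : 0 <= fine (mu E) by rewrite fine_ge0// measure_ge0.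
(* Integrating [H] over E gives [mu E] for its constant 1, and at most 1 for the mean, by
   contraction in L^1. *)
exists ((1 + K1) `^ P * (fine (mu E) + 1)).
  by rewrite -[leLHS]mulr1 ler_pM//; lra.
move=> h f h01 mf f1; have h0 : 0 < h by case/andP: h01.
have [iG G1] := intG mf f1.
have w0 := ball_volumeV_gt0 (n := n) h0.
have g1 : mu.-integrable setT (EFin \o (f \_ E)).
  apply: integrable_patch => //.
  apply: (le_lt_trans (integral_le_modular p mf)).
  by rewrite lte_add_pinfty// (le_lt_trans f1)// ltry.
have G0 t : 0 <= G f t by rewrite /G patchE; case: ifP => // _; exact: powR_ge0.
have key x : E x -> `|steklov E h f x| `^ p x <= (1 + K1) `^ P * (1 + ball_mean h (G
  f) x).
  move=> Ex; set H := 1 + ball_mean h (G f) x.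
  have m0 : 0 <= ball_mean h (G f) x.
    by rewrite mulr_ge0 ?(ltW w0)// Rintegral_ge0.
  have m1 : ball_mean h (G f) x <= (vol * h ^+ n)^-1.
    rewrite -[leLHS]ger0_norm// -[leRHS]mulr1; exact: ball_mean_norm_le_L1.
  have H1 : 1 <= H by rewrite /H; lra.
  have px1 : 1 <= p x by exact: exponent_ge1.
  have px0 : p x != 0 by rewrite gt_eqF//; lra.
  pose s := H `^ (p x)^-1.
  have s1 : 1 <= s by rewrite -[leLHS](powRr0 H) ler_powR// invr_ge0; lra.
  have s0 : 0 < s by lra.
  have sH : s `^ p x = H by rewrite -powRrM mulVf// powRr1//; lra.
  have lnh : 0 < - ln h by rewrite oppr_gt0 ln_lt0// h0/=; case/andP: h01 => _; lra.
  (* Since [1 / p x <= 1] and [1 <= H], one has [s <= H], and [H] is at most of the order of the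
     inverse volume of the ball. *)
  have sK : s `^ (C / - ln h) <= K1.
    apply: (@le_trans _ _ (H `^ (C / - ln h))); last first.
      by apply: volume_power_bound => //; rewrite /H lerD2l.
    rewrite ge0_ler_powR ?nnegrE ?divr_ge0 ?(ltW lnh) ?(ltW s0) ?(ltW C0)//;
      first lra.
    rewrite -[leRHS]powRr1; last lra.
    by rewrite ler_powR// invf_le1//; lra.
  suff sb : `|steklov E h f x| <= (1 + K1) * s.
    apply: (@le_trans _ _ (((1 + K1) * s) `^ p x)).
      by rewrite ge0_ler_powR ?nnegrE ?mulr_ge0 ?(le_trans ler01 px1) ?(ltW s0)
        ?addr_ge0.
    rewrite powRM ?sH; [|lra|exact: ltW].
    by rewrite ler_wpM2r ?ler_powR ?pP ?lerDl ?(le_trans ler01 H1).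
  have mB := measurable_euclid_ball x h.
  have iB := integrable_ball h x g1.
  have iGB := integrable_ball h x iG.
  have Bfin : (mu (euclid_ball x h) < +oo)%E by rewrite [mu _]lebesgue_rV_ball// ltry.
  have icst : mu.-integrable (euclid_ball x h) (EFin \o cst s).
    apply/integrableP; split; first by apply/measurable_EFinP.
    by rewrite /= integral_cst// lte_mul_pinfty ?lee_fin.
  have icG : mu.-integrable (euclid_ball x h) (EFin \o (fun t => K1 * s `^ (1 - p x)
    * G f t)).
    by have := integrableZl mB (K1 * s `^ (1 - p x)) iGB.
  rewrite steklovE /ball_mean normrM (gtr0_norm w0).
  apply: (@le_trans _ _ ((unit_ball_volume R n * h ^+ n)^-1 *
     \int[mu]_(t in euclid_ball x h) (s + K1 * s `^ (1 - p x) * G f t))).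
    rewrite ler_wpM2l ?(ltW w0)//; apply: (le_trans (le_normr_Rintegral mB iB)).
    apply: le_Rintegral => //.
    - exact: integrable_norm.
    - by have := integrableD mB icst icG.
    move=> t xt; rewrite patch_norm patchE /G patchE; case: ifPn => [|_]; last first.
      by rewrite mulr0 addr0 ltW.
    rewrite inE => Et; apply: (@young_split _ _ _ _ (C / - ln h)) => //;
      first exact: exponent_ge1.
    exact: (wLip_ball C0 pLip h01).
  rewrite RintegralD// Rintegral_cst// RintegralZl//.
  rewrite [mu _]lebesgue_rV_ball//= mulrDr mulrCA mulVf ?mulr1 ?gt_eqF
    ?ball_volume_gt0//.
  rewrite mulrDl mul1r lerD2l mulrCA -/(ball_mean h (G f) x) -mulrA ler_wpM2l//.
  (* The choice of [s] pays off here: the mean of [|f|^p] is at most [H = s^(p x)], so the second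
     term of the splitting is again a multiple of [s]. *)
  apply: (@le_trans _ _ (s `^ (1 - p x) * s `^ p x)).
    by rewrite ler_wpM2l ?powR_ge0// sH /H lerDr.
  by rewrite -powRD ?(gt_eqF s0) ?implybT// subrK powRr1// ltW.
have mst : measurable_fun setT (ball_mean h (G f)).
  by apply: measurable_ball_mean; exact: measurable_L1 iG.
have mst' : measurable_fun setT (fun x => `|ball_mean h (G f) x|%:E).
  by apply/measurable_EFinP; exact: measurableT_comp.
have mstE : measurable_fun E (fun x => `|ball_mean h (G f) x|%:E) by exact:
  measurable_funTS.
have mk : measurable_fun E (fun x => 1 + `|ball_mean h (G f) x|%:E)%E.
  exact: emeasurable_funD.
have K1P0 : (0 <= ((1 + K1) `^ P)%:E)%E by rewrite lee_fin powR_ge0.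
apply: (@le_trans _ _ (\int[mu]_(x in E) (((1 + K1) `^ P)%:E * (1 + `|ball_mean h (G
  f) x|%:E)))%E).
  apply: ge0_le_integral => //.
  - apply: measurable_modular; apply: measurable_funTS; rewrite steklovE.
    by apply: measurable_ball_mean; exact: measurable_L1 g1.
  - by apply: emeasurable_funM.
  move=> x Ex; rewrite -EFinD -EFinM lee_fin (le_trans (key x Ex))//.
  by rewrite ler_wpM2l ?powR_ge0// lerD2l ler_norm.
have k0 x : E x -> (0 <= 1 + `|ball_mean h (G f) x|%:E)%E by move=> _;
  exact: adde_ge0.
rewrite (ge0_integralZl_EFin mu mE k0 mk (powR_ge0 _ _)) ge0_integralD//
  integral_cst// mul1e EFinM.
apply: lee_wpmul2l => //; rewrite EFinD fineK ?ge0_fin_numE ?measure_ge0//.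
apply: leeD2l; apply: le_trans G1; apply: (le_trans _ (ball_mean_L1 h0 iG)).
exact: ge0_subset_integral.
Qed.

End log_hoelder.

(** * Convergence of means in L^1 *)

Section L1_cvg.
Context {R : realType} {n : nat}.
Let mu : {measure set 'rV[R]_n -> \bar R} := lebesgue_rV n.
Implicit Types (f g : 'rV[R]_n -> R) (h : R) (x : 'rV[R]_n).

Local Notation L1 g := (mu.-integrable setT (EFin \o g)).
Local Notation N1 g := (\int[mu]_x `|g x|%:E)%E.

Lemma L1B f g : L1 f -> L1 g -> L1 (fun x => f x - g x).
Proof. by move=> i1 i2; have := integrableB measurableT i1 i2. Qed.

Lemma L1D f g : L1 f -> L1 g -> L1 (fun x => f x + g x).
Proof. by move=> i1 i2; have := integrableD measurableT i1 i2. Qed.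

Lemma L1Z (a : R) f : L1 f -> L1 (fun x => a * f x).
Proof. by move=> i1; have := integrableZl measurableT a i1. Qed.

Lemma L1_indic (A : set 'rV[R]_n) : measurable A -> (mu A < +oo)%E -> L1 (\1_A : _ ->
  R).
Proof.
move=> mA Aoo; apply/integrableP; split.
  by apply/measurable_EFinP; exact: measurable_indic.
under eq_integral do rewrite /= ger0_norm//.
by rewrite integral_indic// setIT.
Qed.

Lemma measurable_normE g : L1 g -> measurable_fun setT (fun x => `|g x|%:E).
Proof. by move=> /measurable_L1 mg; apply/measurable_EFinP;
  exact: measurableT_comp. Qed.

Lemma N1_triangle f g k : L1 f -> L1 g -> L1 k ->
  (forall x, `|f x| <= `|g x| + `|k x|) -> (N1 f <= N1 g + N1 k)%E.
Proof.
move=> i1 i2 i3 H; rewrite -ge0_integralD//; try exact: measurable_normE.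
apply: ge0_le_integral => //; first exact: measurable_normE.
- by apply: emeasurable_funD; exact: measurable_normE.
- by move=> x _; rewrite -EFinD lee_fin.
Qed.

Definition mean_cvg g : Prop := forall e : R, 0 < e ->
  exists2 h0 : R, 0 < h0 & forall h, 0 < h < h0 ->
    (N1 (fun x => ball_mean h g x - g x)%R <= e%:E)%E.

Lemma mean_cvgD f g : L1 f -> L1 g -> mean_cvg f -> mean_cvg g ->
  mean_cvg (fun x => f x + g x).
Proof.
move=> i1 i2 c1 c2 e e0; have e2 : 0 < e / 2 by rewrite divr_gt0.
have [h1 h10 H1] := c1 _ e2; have [h2 h20 H2] := c2 _ e2.
exists (Num.min h1 h2); first by rewrite lt_min h10.
move=> h /andP[h0]; rewrite lt_min => /andP[hh1 hh2].
have L k : L1 k -> L1 (fun x => ball_mean h k x - k x).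
  by move=> ik; apply: L1B => //; exact: integrable_ball_mean.
rewrite (splitr e) EFinD.
apply: (@le_trans _ _ (N1 (fun x => ball_mean h f x - f x)%R + N1 (fun x => ball_mean
  h g x - g x)%R)%E).
  apply: N1_triangle; [exact/L/L1D|exact: L|exact: L|] => x.
  rewrite ball_meanD//.
  have -> : ball_mean h f x + ball_mean h g x - (f x + g x) =
    (ball_mean h f x - f x) + (ball_mean h g x - g x) by ring.
  exact: ler_normD.
by apply: leeD; [apply: H1; rewrite h0|apply: H2; rewrite h0].
Qed.

Lemma mean_cvgZ (a : R) g : L1 g -> mean_cvg g -> mean_cvg (fun x => a * g x).
Proof.
move=> ig cg e e0.
have a1 : 0 < `|a| + 1 by rewrite ltr_wpDl.
have [h1 h10 H1] := cg _ (divr_gt0 e0 a1).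
exists h1 => // h /[dup] hh /andP[h0 _].
apply: (@le_trans _ _ (`|a|%:E * N1 (fun x => ball_mean h g x - g x)%R)%E).
  rewrite -ge0_integralZl//; last first.
    by apply: measurable_normE; apply: L1B => //; exact: integrable_ball_mean.
  rewrite le_eqVlt; apply/orP; left; apply/eqP; apply: eq_integral => x _.
  by rewrite ball_meanZ// -mulrBr normrM EFinM.
apply: (@le_trans _ _ (`|a|%:E * (e / (`|a| + 1))%:E)%E).
  by apply: lee_wpmul2l => //; exact: H1.
by rewrite -EFinM lee_fin mulrA ler_pdivrMr// mulrC ler_pM2l// lerDl.
Qed.

Lemma mean_cvgB f g : L1 f -> L1 g -> mean_cvg f -> mean_cvg g ->
  mean_cvg (fun x => f x - g x).
Proof.
move=> i1 i2 c1 c2; under eq_fun do rewrite -mulN1r.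
by apply: mean_cvgD => //; [exact: L1Z|exact: mean_cvgZ].
Qed.

(** Contraction in L^1: passing from [f] to [g] costs at most twice their L^1 distance, uniformly in
    [h]. *)
Lemma mean_cvg_closed g : L1 g ->
  (forall e : R, 0 < e -> exists f, [/\ L1 f, mean_cvg f & (N1 (fun x => g x - f x)%R
    <= e%:E)%E]) ->
  mean_cvg g.
Proof.
move=> ig H e e0; have e4 : 0 < e / 4 by rewrite divr_gt0.
have [f [if_ cf gf]] := H _ e4.
have [h0 h00 Hh] := cf _ e4; exists h0 => // h /[dup] hh /andP[hp _].
have igf := L1B ig if_.
have imgf := integrable_ball_mean hp igf.
have imf : L1 (fun x => ball_mean h f x - f x) by apply: L1B => //;
  exact: integrable_ball_mean.
have img : L1 (fun x => ball_mean h g x - g x) by apply: L1B => //;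
  exact: integrable_ball_mean.
have imm : L1 (fun x => (ball_mean h g x - g x) + (g x - f x)) by exact: L1D.
apply: (@le_trans _ _ (((e / 4)%:E + (e / 4)%:E) + (e / 4)%:E)%E); last first.
  by rewrite -!EFinD lee_fin; lra.
apply: (@le_trans _ _ (N1 (fun x => (ball_mean h g x - g x) + (g x - f x))%R + N1
  (fun x => g x - f x)%R)%E).
  apply: N1_triangle => // x.
  have {1}-> : ball_mean h g x - g x = (ball_mean h g x - g x + (g x - f x)) - (g x -
    f x) by ring.
  by rewrite (le_trans (ler_normB _ _)).
apply: leeD => //.
apply: (@le_trans _ _ (N1 (ball_mean h (fun t => g t - f t)%R) + N1 (fun x =>
  ball_mean h f x - f x)%R)%E).
  apply: N1_triangle => // x; rewrite ball_meanB//.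
  have -> : ball_mean h g x - g x + (g x - f x) =
    (ball_mean h g x - ball_mean h f x) + (ball_mean h f x - f x) by ring.
  exact: ler_normD.
apply: leeD; last exact: Hh.
exact: le_trans (ball_mean_L1 hp igf) gf.
Qed.

Lemma nondecreasing_tail (A : (set 'rV[R]_n)^nat) (e : R) : (forall k, measurable (A
  k)) ->
  (forall i j, (i <= j)%N -> A i `<=` A j) -> (mu (\bigcup_k A k) < +oo)%E -> 0 < e ->
  exists k, (mu (\bigcup_k A k `\` A k) <= e%:E)%E.
Proof.
move=> mA ndA Aoo e0; set S := \bigcup_k A k.
have mS : measurable S by exact: bigcup_measurable.
have Sfin : mu S \is a fin_num by rewrite ge0_fin_numE ?measure_ge0.
have AS k : A k `<=` S by move=> x Akx; exists k.
have Afin k : mu (A k) \is a fin_num.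
  rewrite ge0_fin_numE ?measure_ge0// (le_lt_trans _ Aoo)//.
  by apply: le_measure; rewrite ?inE//; exact: AS.
have cv : mu \o A @ \oo --> mu S.
  by apply: nondecreasing_cvg_mu => // i j ij; exact/subsetPset/ndA.
have : fine \o (mu \o A) @ \oo --> fine (mu S).
  by apply: fine_cvg; rewrite fineK.
move=> /cvgrPdist_lt /(_ _ e0)[k _ /(_ k (leqnn k))/= Hk].
exists k; have -> : (mu (S `\` A k) = (fine (mu S) - fine (mu (A k)))%:E)%E.
  have SA : S `&` A k = A k by apply: setIidr; exact: AS.
  by rewrite measureD// SA EFinB !fineK.
by rewrite lee_fin (le_trans (ler_norm _))// ltW.
Qed.

Lemma ball_mean_indic (h : R) (A : set 'rV[R]_n) x : measurable A ->
  ball_mean h (\1_A) x = (unit_ball_volume R n * h ^+ n)^-1 * fine (mu (A `&`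
    euclid_ball x h)).
Proof.
move=> mA; congr (_ * fine _); apply: integral_indic => //;
  exact: measurable_euclid_ball.
Qed.

(* The mean of [\1_U] is 1 at the points of [U] that are far from the complement,
   and its total mass is at most [mu U], so little mass is left outside [U]. *)
Lemma mean_cvg_open (U : set 'rV[R]_n) : open U -> (mu U < +oo)%E -> mean_cvg (\1_U).
Proof.
move=> oU Uoo e e0.
have mU : measurable U by exact: open_measurable_mx.
pose A k := [set x | euclid_ball x k.+1%:R^-1 `<=` U].
have mA k : measurable (A k).
  rewrite -[A k]setCK; apply: measurableC; apply: open_measurable_mx.
  rewrite (_ : ~` A k = \bigcup_(y in ~` U) euclid_ball y k.+1%:R^-1); last first.
    apply/seteqP; split=> x /=.
      by move=> /existsNP[y /not_implyP[xy Uy]]; exists y => //;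
        exact: euclid_ball_sym.
    by move=> [y Uy xy] H; apply: Uy; apply: H; exact: euclid_ball_sym.
  by apply: bigcup_open => y _; exact: open_euclid_ball.
have ndA i j : (i <= j)%N -> A i `<=` A j.
  move=> ij x Ax y xy; apply: Ax; apply: le_euclid_ball xy.
  by rewrite lef_pV2 ?posrE// ler_nat.
have UE : \bigcup_k A k = U.
  apply/seteqP; split=> x.
    by move=> [k _ /(_ x)]; apply; apply: euclid_ball_center; rewrite invr_gt0.
  move=> Ux; have [r r0 rU] := euclid_ball_nbhs oU Ux.
  exists (Num.truncn r^-1) => //; apply: subset_trans rU; apply: le_euclid_ball.
  by rewrite -[leRHS]invrK lef_pV2 ?posrE ?invr_gt0// ltW// truncnS_gt.
have e2 : 0 < e / 2 by rewrite divr_gt0.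
have [k Hk] : exists k, (mu (U `\` A k) <= (e / 2)%:E)%E.
  by have := nondecreasing_tail mA ndA; rewrite UE => /(_ _ Uoo e2).
exists k.+1%:R^-1 => // h /andP[h0 hk].
have i1 := L1_indic mU Uoo.
have vh0 := ball_volume_gt0 n h0.
pose b := ball_mean h (\1_U : _ -> R).
have ib : L1 b by exact: integrable_ball_mean.
have mUb x : (mu (U `&` euclid_ball x h) <= (unit_ball_volume R n * h ^+ n)%:E)%E.
  rewrite -(lebesgue_rV_ball x h0); apply: le_measure; rewrite ?inE.
  - by apply: measurableI => //; exact: measurable_euclid_ball.
  - exact: measurable_euclid_ball.
  - exact: subIsetr.
have b0 x : 0 <= b x.
  by rewrite /b ball_mean_indic// mulr_ge0 ?invr_ge0 ?(ltW vh0)// fine_ge0//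
    measure_ge0.
have b1 x : b x <= 1.
  rewrite /b ball_mean_indic// mulrC ler_pdivrMr// mul1r -lee_fin fineK//.
  by rewrite ge0_fin_numE ?measure_ge0// (le_lt_trans (mUb x))// ltry.
have bA x : A k x -> b x = 1.
  move=> Ax; rewrite /b ball_mean_indic// setIidr; last first.
    by apply: subset_trans Ax; apply: le_euclid_ball; exact: ltW.
  by rewrite [mu _]lebesgue_rV_ball//= mulVf// gt_eqF.
(* Pointwise, [|b - 1_U| + 1_U <= b + 2 * 1_(U \ A k)], as [b] is 1 on [A k] and lies between 0 and
   1. The integral of [b] is at most [mu U], which then cancels. *)
have : (N1 (fun x => b x - \1_U x)%R + mu U <= mu U + e%:E)%E.
  apply: (@le_trans _ _ (\int[mu]_x (`|b x|%:E + 2%:E * (\1_(U `\` A k) x)%:E))%E).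
    have -> : (mu U = \int[mu]_x (\1_U x)%:E)%E by rewrite integral_indic ?setIT.
    rewrite -ge0_integralD//; last 2 first.
    - by apply: measurable_normE; exact: L1B.
    - by apply/measurable_EFinP; exact: measurable_indic.
    apply: ge0_le_integral => //.
    - by move=> x _; rewrite adde_ge0// lee_fin.
    - apply: emeasurable_funD; first by apply: measurable_normE; exact: L1B.
      by apply/measurable_EFinP; exact: measurable_indic.
    - apply: emeasurable_funD; first exact: measurable_normE.
      apply: emeasurable_funM => //; apply/measurable_EFinP; apply: measurable_indic.
      exact: measurableD.
    move=> x _; rewrite -EFinM -!EFinD lee_fin.
    have := b0 x; have := b1 x; rewrite !indicE in_setD.
    case: (boolP (x \in U)) => xU; case: (boolP (x \in A k)) => xA /=.
    - by move: xA; rewrite inE => /bA -> _ _; rewrite subrr normr0 normr1; lra.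
    - move=> h1 h2; rewrite ler0_norm; last lra.
      by rewrite ger0_norm//; lra.
    - by move=> _ _; rewrite subr0; lra.
    - by move=> _ _; rewrite subr0; lra.
  rewrite ge0_integralD//; last 2 first.
  - exact: measurable_normE.
  - apply: emeasurable_funM => //; apply/measurable_EFinP; apply: measurable_indic.
    exact: measurableD.
  apply: leeD.
    apply: (le_trans (ball_mean_L1 h0 i1)).
    under eq_integral do rewrite ger0_norm//.
    by rewrite integral_indic// setIT.
  rewrite ge0_integralZl//; last first.
    by apply/measurable_EFinP; apply: measurable_indic; exact: measurableD.
  rewrite integral_indic ?setIT//; last exact: measurableD.
  have -> : (e%:E = 2%:E * (e / 2)%:E)%E by rewrite -EFinM mulrC divfK.
  by apply: lee_wpmul2l => //; rewrite lee_fin.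
by rewrite addeC leeD2lE// ge0_fin_numE ?measure_ge0.
Qed.

Lemma indicU_disj (A B : set 'rV[R]_n) : A `&` B = set0 ->
  \1_(A `|` B) = (fun x => \1_A x + \1_B x) :> (_ -> R).
Proof.
move=> AB; apply/funext => x; rewrite !indicE in_setU.
have [xA|xA] := boolP (x \in A); have [xB|xB] := boolP (x \in B);
  rewrite /= ?addr0 ?add0r//.
by move: xA xB; rewrite !inE => xA xB; have : (A `&` B) x by []; rewrite AB.
Qed.

Lemma indicD_sub (A B : set 'rV[R]_n) : B `<=` A ->
  \1_(A `\` B) = (fun x => \1_A x - \1_B x) :> (_ -> R).
Proof.
move=> BA; apply/funext => x; rewrite !indicE in_setD.
have [xB|xB] := boolP (x \in B); last by rewrite subr0 andbT.
have -> : x \in A by move: xB; rewrite !inE; exact: BA.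
by rewrite subrr.
Qed.

(** Intersecting with [Q] keeps all indicators integrable, so that a complement becomes a difference
    from [Q], and a countable disjoint union an L^1 limit of finite ones. Open sets are stable under
    intersection and generate the sigma-algebra. *)
Lemma mean_cvg_indic (Q S : set 'rV[R]_n) : open Q -> (mu Q < +oo)%E ->
  measurable S -> mean_cvg (\1_(S `&` Q)).
Proof.
move=> oQ Qoo mS; have mQ := open_measurable_mx oQ.
have fin A : measurable A -> (mu (A `&` Q) < +oo)%E.
  move=> mA; rewrite (le_lt_trans _ Qoo)//; apply: le_measure; rewrite ?inE//.
  exact: measurableI.
have i1 A : measurable A -> L1 (\1_(A `&` Q) : _ -> R).
  by move=> mA; apply: L1_indic; [exact: measurableI|exact: fin].
suff H : forall A, <<s @open 'rV[R]_n >> A -> mean_cvg (\1_(A `&` Q)) by exact: H.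
apply: (@dynkin_induction _ 'rV[R]_n (@open 'rV[R]_n)) => //.
- exact: openI.
- by rewrite setTI; exact: mean_cvg_open.
- move=> U oU; apply: mean_cvg_open; first exact: openI.
  by apply: fin; exact: open_measurable_mx.
- move=> A mA cA.
  have -> : ~` A `&` Q = Q `\` (A `&` Q).
    by rewrite setDIr setDv setU0 setIC setDE.
  rewrite indicD_sub; last exact: subIsetr.
  by apply: mean_cvgB => //; [exact: L1_indic|exact: i1|exact: mean_cvg_open].
move=> F mF tF cF.
pose A N := \big[setU/set0]_(k < N) F k.
have mA N : measurable (A N) by exact: bigsetU_measurable.
have AE : \bigcup_k F k `&` Q = \bigcup_N (A N `&` Q).
  apply/seteqP; split=> x.
    by move=> [[k _ Fk] Qx]; exists k.+1 => //; split => //;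
      rewrite /A -bigcup_mkord; exists k => /=.
  move=> [N _ []]; rewrite /A -bigcup_mkord => -[k _ Fk] Qx.
  by split => //; exists k.
have cA N : mean_cvg (\1_(A N `&` Q)).
  elim: N => [|N IH]; first by rewrite /A big_ord0 set0I -(set0I Q);
    apply: mean_cvg_open; [rewrite set0I; exact: open0|rewrite set0I measure0].
  rewrite /A big_ord_recr/= -/(A N) setIUl indicU_disj; last first.
    rewrite setIACA setIid; rewrite (_ : A N `&` F N = set0) ?set0I//.
    rewrite /A -bigcup_mkord; apply/seteqP; split => // x [[k /= kN Fk] FN].
    have kNE : k = N by apply: (tF k N) => //; exists x.
    by move: kN; rewrite kNE ltnn.
  by apply: mean_cvgD => //; exact: i1.
have mU : measurable (\bigcup_k F k) by exact: bigcup_measurable.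
apply: mean_cvg_closed; first exact: i1.
move=> e e0.
have [k Hk] : exists k, (mu (\bigcup_k F k `&` Q `\` (A k `&` Q)) <= e%:E)%E.
  rewrite AE; apply: nondecreasing_tail => //.
  - by move=> k; exact: measurableI.
  - move=> i j ij; rewrite /A -!bigcup_mkord => x [[m /= mi Fm] Qx].
    by split => //; exists m => //=; exact: leq_trans mi ij.
  - by rewrite -AE; exact: fin.
exists (\1_(A k `&` Q)); split => //; first exact: i1.
have AkS : A k `&` Q `<=` \bigcup_k F k `&` Q by rewrite AE => x Ax; exists k.
rewrite (eq_integral (fun x => (\1_(\bigcup_k F k `&` Q `\` (A k `&` Q)) x)%:E));
  last first.
  move=> x _; have <- : \1_(\bigcup_k F k `&` Q `\` (A k `&` Q)) x =
    \1_(\bigcup_k F k `&` Q) x - \1_(A k `&` Q) x :> R by rewrite (indicD_sub AkS).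
  by rewrite ger0_norm.
rewrite integral_indic ?setIT//; apply: measurableD; exact: measurableI.
Qed.

Lemma mean_cvg_sum (I : Type) (s : seq I) (F : I -> 'rV[R]_n -> R) :
  (forall i, L1 (F i)) -> (forall i, mean_cvg (F i)) ->
  mean_cvg (fun x => \sum_(i <- s) F i x) /\ L1 (fun x => \sum_(i <- s) F i x).
Proof.
move=> iF cF; elim: s => [|i s [IHc IHi]].
  under eq_fun do rewrite big_nil.
  have h0 : mean_cvg (\1_(set0 : set 'rV[R]_n)).
    by apply: mean_cvg_open; [exact: open0|rewrite measure0].
  have i0 : L1 (\1_(set0 : set 'rV[R]_n) : _ -> R) by apply: L1_indic => //;
    rewrite measure0.
  by move: h0 i0; rewrite indic0.
under eq_fun do rewrite big_cons.
by split; [exact: mean_cvgD|exact: L1D].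
Qed.

Import HBSimple.

(** Simple functions are dense in L^1(Q); cut to [Q], they are finite combinations of the indicators
    of [mean_cvg_indic]. *)
Lemma mean_cvg_L1 (Q : set 'rV[R]_n) g : open Q -> (mu Q < +oo)%E -> L1 g ->
  (forall x, ~ Q x -> g x = 0) -> mean_cvg g.
Proof.
move=> oQ Qoo ig gQ; have mQ := open_measurable_mx oQ.
have igQ : mu.-integrable Q (EFin \o g) by apply: integrableS ig.
apply: mean_cvg_closed => // e e0.
have [f_ [if_ _ cf]] := approximation_sfun_integrable mQ igQ.
have [k Hk] : exists k, (\int[mu]_(z in Q) `|(g z)%:E - (f_ k z)%:E| <= e%:E)%E.
  move/fine_cvgP : cf => [[m _ Hm]] /cvgrPdist_lt /(_ _ e0)[k _ Hk].
  exists (maxn m k); have /= := Hk _ (leq_maxr m k).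
  have := Hm _ (leq_maxl m k) => /= fin.
  rewrite sub0r normrN => /ltW/(le_trans (ler_norm _)).
  by rewrite -lee_fin fineK.
exists (f_ k \_ Q).
pose s := finmap.enum_fset (fset_set (range (f_ k))).
have fE : f_ k \_ Q = (fun x => \sum_(c <- s) c * \1_(f_ k @^-1` [set c] `&` Q) x).
  apply/funext => x; rewrite patchE; case: ifPn => xQ.
    rewrite fimfunE fsbig_finite//=; apply: eq_bigr => c _.
    by rewrite !indicE in_setI xQ andbT.
  by rewrite big1// => c _; rewrite indicE in_setI (negbTE xQ) andbF mulr0.
have i1 c : L1 (\1_(f_ k @^-1` [set c] `&` Q) : _ -> R).
  apply: L1_indic; first exact: measurableI.
  rewrite (le_lt_trans _ Qoo)//; apply: le_measure; rewrite ?inE//.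
  exact: measurableI.
have [] := @mean_cvg_sum R s (fun c x => c * \1_(f_ k @^-1` [set c] `&` Q) x).
- by move=> c; exact: L1Z.
- by move=> c; apply: mean_cvgZ => //; exact: mean_cvg_indic.
rewrite -fE => c1 i2; split => //.
apply: le_trans Hk; rewrite [leRHS]integral_mkcond le_eqVlt; apply/orP; left;
  apply/eqP.
apply: eq_integral => x _; rewrite !patchE; case: ifPn => xQ;
  first by rewrite -EFinB abse_EFin.
by rewrite gQ ?subrr ?normr0//; rewrite notin_setE in xQ.
Qed.

End L1_cvg.

(** * Necessity *)

Section finite_net.
Context {R : realType} {V : normedModType R}.

Lemma compact_finite_net (F : set V) (e : R) : compact (closure F) -> 0 < e ->
  exists s : seq V, forall f, F f -> exists2 g, g \in s & `|f - g| < e.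
Proof.
move=> cF e0; move: cF; rewrite compact_cover => /(_ V setT (fun g => ball g e)).
case=> [g _|x _|D _ FD].
- exact: ball_open.
- by exists x => //; exact: ballxx.
exists (finmap.enum_fset D) => f Ff.
have [g gD gf] := FD _ (subset_closure Ff).
by exists g => //; move: gf; rewrite -ball_normE /ball_/= distrC.
Qed.

Lemma seq_common_threshold (T : eqType) (s : seq T) (P : T -> R -> Prop) :
  (forall g, g \in s -> exists2 h0, 0 < h0 & forall h, 0 < h < h0 -> P g h) ->
  exists2 h0, 0 < h0 & forall h, 0 < h < h0 -> forall g, g \in s -> P g h.
Proof.
elim: s => [_|g s IH H]; first by exists 1.
have [h1 h10 H1] := H g (mem_head _ _).
have [|h2 h20 H2] := IH; first by move=> k ks; apply: H; rewrite in_cons ks orbT.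
exists (Num.min h1 h2); first by rewrite lt_min h10.
move=> h /andP[h0]; rewrite lt_min => /andP[hh1 hh2] k.
rewrite in_cons => /orP[/eqP->|ks]; first by apply: H1; rewrite h0.
by apply: H2 => //; rewrite h0.
Qed.

End finite_net.

Section necessity.
Context {R : realType} {n : nat} {E : set 'rV[R]_n} (p : bounded_exponent E).
Let mu : {measure set 'rV[R]_n -> \bar R} := lebesgue_rV n.
Let mE : measurable E := measurable_exponent_dom p.
Variable rho : R.
Hypothesis Erho : E `<=` euclid_ball 0 rho.
Implicit Types f g : 'rV[R]_n -> R.

Lemma bounded_fin_measure : (mu E < +oo)%E.
Proof.
apply: le_lt_trans (lebesgue_rV_ball_lty n rho); apply: le_measure; rewrite ?inE//.
exact: measurable_euclid_ball.
Qed.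
Let Efin := bounded_fin_measure.

Lemma modular_L1_patch f : measurable_fun E f -> (modular p f < +oo)%E ->
  mu.-integrable setT (EFin \o (f \_ E)).
Proof.
move=> mf foo; apply: integrable_patch => //.
by apply: (le_lt_trans (integral_le_modular p mf)); rewrite lte_add_pinfty.
Qed.

Lemma patchB f g : (fun x => f x - g x) \_ E = (fun x => (f \_ E) x - (g \_ E) x).
Proof. by apply/funext => x; rewrite !patchE; case: ifP => // _; rewrite subr0. Qed.

Lemma steklovB h f g x : mu.-integrable setT (EFin \o (f \_ E)) ->
  mu.-integrable setT (EFin \o (g \_ E)) ->
  steklov E h (fun t => f t - g t) x = steklov E h f x - steklov E h g x.
Proof. by move=> i1 i2; rewrite !steklovE patchB ball_meanB. Qed.

Lemma measurable_steklov h f (D : set 'rV[R]_n) : measurable_fun E f ->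
  measurable_fun D (steklov E h f).
Proof.
move=> mf; apply: measurable_funTS; rewrite steklovE; apply: measurable_ball_mean.
exact/(measurable_restrictT _ mE).
Qed.

Lemma steklov_sup_le h f (M : R) x : 0 < h -> 0 <= M -> measurable_fun E f -> (forall
  t, E t -> `|f t| <= M) ->
  mu.-integrable setT (EFin \o (f \_ E)) -> `|steklov E h f x| <= M.
Proof.
move=> h0 M0 mf fM i1; rewrite steklovE -lee_fin (le_trans (ball_mean_norm_le x h0
  i1))//.
have v0 := ball_volume_gt0 n h0.
have -> : M%:E = ((unit_ball_volume R n * h ^+ n)^-1%:E * (M%:E * (unit_ball_volume R
  n * h ^+ n)%:E))%E.
  by rewrite muleCA -!EFinM mulVf ?mulr1// gt_eqF.
apply: lee_wpmul2l; first by rewrite lee_fin invr_ge0 ltW.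
have mB := measurable_euclid_ball x h.
rewrite -(lebesgue_rV_ball x h0) -/(mu _) -integral_cst//.
apply: ge0_le_integral => //.
- by apply/measurable_EFinP; apply: measurableT_comp => //; apply: measurable_funTS;
  exact: measurable_L1 i1.
- by move=> t _; rewrite lee_fin patchE; case: ifPn => [|_]; [rewrite inE;
  exact: fM|rewrite normr0].
Qed.

Variable P : R.
Hypothesis P1 : 1 <= P.
Hypothesis pP : forall x, E x -> p x <= P.

(** From modular to norm by convexity: as [K >= 1], dividing a function of modular at most [K] by
    [K] brings its modular below 1. *)
Lemma steklov_luxemburg_bound : wLip p -> exists2 K : R, 1 <= K &
  forall h f (a : R), 0 < h <= 2^-1 -> measurable_fun E f -> (luxemburg_norm p f <
    a%:E)%E ->
    (luxemburg_norm p (steklov E h f) <= (a * K)%:E)%E.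
Proof.
move=> /(steklov_modular_bound Efin P1 pP)[K K1 HK]; exists K => // h f a h01 mf fa.
have a0 : 0 < a by rewrite -lte_fin (le_lt_trans (luxemburg_norm_ge0 p f)).
have K0 : 0 < K by lra.
have mfa := measurable_fun_mulr_cst a^-1 mf.
have fa1 := luxemburg_norm_lt mf fa.
have i1 := modular_L1_patch mf (luxemburg_norm_fin_modular mf fa).
apply: luxemburg_norm_le; first exact: mulr_gt0.
have -> : (fun x => steklov E h f x / (a * K)) = (fun x => K^-1 * steklov E h (fun t
  => f t / a) x).
  apply/funext => x; rewrite !steklovE.
  have -> : (fun t => f t / a) \_ E = (fun t => a^-1 * (f \_ E) t).
    by apply/funext => t; rewrite !patchE; case: ifP => _; rewrite ?mulr0// mulrC.
  by rewrite ball_meanZ// invfM mulrC [a^-1 * _]mulrC -mulrA.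
apply: (le_trans (modularZ_le p _ _ _)).
- exact: measurable_steklov.
- by rewrite invr_ge0 ltW.
- by rewrite invf_le1.
apply: (@le_trans _ _ (K^-1%:E * K%:E)%E); last by rewrite -EFinM mulVf// gt_eqF.
by apply: lee_wpmul2l; [rewrite lee_fin invr_ge0 ltW|exact: HK].
Qed.

(** Large values are replaced by 0, so at each point [f - g k] vanishes from some [k] on, and
    [|f / a|^p] dominates. Once the modular of [(f - g k) / a] is at most 1, the norm is at most
    [a]. *)
Lemma truncation_dense f (eta : R) : measurable_fun E f -> (modular p f < +oo)%E -> 0
  < eta ->
  exists M : R, exists g, [/\ 0 <= M, measurable_fun E g, forall x, E x -> `|g x| <=
    M &
    (luxemburg_norm p (fun x => f x - g x)%R < eta%:E)%E].
Proof.
move=> mf foo eta0; pose a := eta / 2; have a0 : 0 < a by rewrite divr_gt0.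
pose g (k : nat) x := if `|f x| <= k%:R then f x else 0.
have mg k : measurable_fun E (g k).
  apply: measurable_fun_if => //.
  - apply: measurable_fun_ler => //; exact: measurableT_comp.
  - exact: measurable_funS mf.
have mfg k : measurable_fun E (fun x => f x - g k x) by exact: measurable_funB.
pose F k x := (`|(f x - g k x) / a| `^ p x)%:E.
have mF k : measurable_fun E (F k).
  by apply: measurable_modular; exact: measurable_fun_mulr_cst.
have mfa := measurable_fun_mulr_cst a^-1 mf.
have iG : mu.-integrable E (fun x => (`|f x / a| `^ p x)%:E).
  apply/integrableP; split; first exact: measurable_modular.
  under eq_integral do rewrite gee0_abs ?lee_fin ?powR_ge0//.
  by have := modularZ_lty a^-1 mf foo; under eq_fun do rewrite mulrC.
have px0 x : E x -> p x != 0 by move=> Ex;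
  rewrite gt_eqF// (lt_le_trans ltr01)// exponent_ge1.
have Fcvg : {ae mu, forall x, E x -> F^~ x @ \oo --> cst 0%E x}.
  apply: aeW => x Ex; apply: cvg_near_cst; near=> k.
  have fk : `|f x| <= k%:R.
    by near: k; exists (Num.truncn `|f x|).+1 => // j /= jk;
      rewrite (le_trans (ltW (truncnS_gt _)))// ler_nat.
  by rewrite /F /g fk subrr mul0r normr0 powR0// px0.
have Fle : {ae mu, forall x k, E x -> (`|F k x| <= (`|f x / a| `^ p x)%:E)%E}.
  apply: aeW => x k Ex; rewrite gee0_abs ?lee_fin ?powR_ge0//.
  rewrite ge0_ler_powR ?nnegrE//; first by rewrite (le_trans ler01)// exponent_ge1.
  rewrite !normrM ler_wpM2r// /g; case: ifP => _; last by rewrite subr0.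
  by rewrite subrr normr0.
have [_ _] := dominated_convergence mE mF (measurable_cst 0%E) Fcvg iG Fle.
rewrite integral0 => /fine_cvgP[[m _ Hm]] /cvgrPdist_lt /(_ _ ltr01)[k _ Hk].
pose N := maxn m k.
exists N%:R, (g N); split => //.
  by move=> x _; rewrite /g; case: ifP => // _; rewrite normr0.
apply: (@le_lt_trans _ _ a%:E); last by rewrite lte_fin /a; lra.
apply: luxemburg_norm_le => //.
have := Hk _ (leq_maxr m k); have := Hm _ (leq_maxl m k) => /= fin.
rewrite sub0r normrN => /ltW/(le_trans (ler_norm _)).
by rewrite -lee_fin fineK.
Unshelve. all: by end_near. Qed.

Lemma steklov_cvg_single f : wLip p -> measurable_fun E f -> (modular p f < +oo)%E ->
  forall eps : R, 0 < eps -> exists2 h0 : R, 0 < h0 & forall h, 0 < h < h0 ->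
    (luxemburg_norm p (fun x => steklov E h f x - f x)%R < eps%:E)%E.
Proof.
move=> pL mf foo eps e0; have [K K1 HK] := steklov_luxemburg_bound pL.
have K0 : 0 < K by lra.
(* The mean of [f - g] then costs at most [eta * K = eps / 4], and [f - g] itself less than
   [eps / 4]. *)
pose eta := eps / (4 * K).
have eta0 : 0 < eta by rewrite divr_gt0// mulr_gt0.
have etaK : eta * K = eps / 4 by rewrite /eta; field; rewrite gt_eqF.
have eta4 : eta <= eps / 4 by rewrite -etaK ler_peMr// ltW.
have [M [g [M0 mg gM fg]]] := truncation_dense mf foo eta0.
have mfg : measurable_fun E (fun x => f x - g x) by exact: measurable_funB.
have fgoo := luxemburg_norm_fin_modular mfg fg.
have goo : (modular p g < +oo)%E.
  have gE : g = (fun x => f x + -1 * (f x - g x)) by apply/funext => x; ring.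
  have m1 : measurable_fun E (fun x => -1 * (f x - g x)) by exact: measurable_funM.
  by rewrite gE; exact: (modularD_lty mf m1 foo (modularZ_lty (-1) mfg fgoo)).
have if1 := modular_L1_patch mf foo.
have ig1 := modular_L1_patch mg goo.
have ifg1 := modular_L1_patch mfg fgoo.
have e4 : 0 < eps / 4 by rewrite divr_gt0.
have e42 : eps / 4 < eps / 2 by lra.
have epsE : eps = eps / 2 + (eps / 4 + eps / 4) by lra.
(* A mean does not exceed the sup of the function, so [steklov h g - g] is bounded by [2 * M] for
   every [h], and its L^1 convergence suffices. *)
have [d d0 Hd] := luxemburg_norm_small_L1 pP (2 * M) e4.
have [h1 h10 H1] : exists2 h0, 0 < h0 & forall h, 0 < h < h0 ->
    (\int[mu]_x `|ball_mean h (g \_ E) x - (g \_ E) x|%:E <= d%:E)%E.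
  have := @mean_cvg_L1 _ _ _ (g \_ E) (@open_euclid_ball R n 0 rho)
    (lebesgue_rV_ball_lty n rho) ig1.
  apply => // x Bx; rewrite patchE memNset// => Ex; apply: Bx; exact: Erho.
exists (Num.min h1 2^-1); first by rewrite lt_min h10 invr_gt0 ltr0n.
move=> h /andP[h0]; rewrite lt_min => /andP[hh1 hh2].
have h01 : 0 < h <= 2^-1 by rewrite h0 ltW.
have -> : (fun x => steklov E h f x - f x) =
  (fun x => steklov E h (fun t => f t - g t) x + ((steklov E h g x - g x) + - (f x -
    g x))).
  by apply/funext => x; rewrite steklovB//; ring.
have mS1 : measurable_fun E (steklov E h (fun t => f t - g t)) by exact:
  measurable_steklov.
have mS2 : measurable_fun E (fun x => steklov E h g x - g x).
  by apply: measurable_funB => //; exact: measurable_steklov.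
have mS3 : measurable_fun E (fun x => - (f x - g x)) by exact: measurableT_comp.
rewrite epsE.
apply: luxemburg_normD_lt => //; first exact: measurable_funD.
  by apply: (le_lt_trans (HK _ _ _ h01 mfg fg)); rewrite etaK lte_fin.
apply: luxemburg_normD_lt => //; last first.
  by rewrite luxemburg_normN// (lt_le_trans fg)// lee_fin.
apply: Hd => //.
  move=> x Ex; rewrite (le_trans (ler_normB _ _))// mulr2n mulrDl mul1r lerD ?gM//.
  exact: steklov_sup_le.
apply: le_trans (H1 h _); last by rewrite h0.
rewrite [leLHS](_ : _ = \int[mu]_(x in E) `|ball_mean h (g \_ E) x - (g \_ E)
  x|%:E)%E; last first.
  by apply: eq_integral => x xE; rewrite patchE xE.
apply: ge0_subset_integral => //; apply/measurable_EFinP;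
  apply: measurableT_comp => //.
apply: measurable_funB; last exact: measurable_L1 ig1.
by apply: measurable_ball_mean; exact: measurable_L1 ig1.
Qed.

Lemma compact_steklov_uniform (F : set (Lvar p)) : wLip p -> compact (closure F) ->
  forall eps : R, 0 < eps ->
    exists2 h0 : R, 0 < h0 &
      forall h : R, 0 < h < h0 -> forall f : Lvar p, F f ->
        (luxemburg_norm p (fun x => (steklov E h f x - f x)%R) < eps%:E)%E.
Proof.
move=> pL cF eps e0; have [K K1 HK] := steklov_luxemburg_bound pL.
have K0 : 0 < K by lra.
pose eta := eps / (4 * K).
have eta0 : 0 < eta by rewrite divr_gt0// mulr_gt0.
have etaK : eta * K = eps / 4 by rewrite /eta; field; rewrite gt_eqF.
have eta4 : eta <= eps / 4 by rewrite -etaK ler_peMr// ltW.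
have e4 : 0 < eps / 4 by rewrite divr_gt0.
have e42 : eps / 4 < eps / 2 by lra.
have epsE : eps = eps / 2 + (eps / 4 + eps / 4) by lra.
have [s Hs] := compact_finite_net cF eta0.
have [|h1 h10 H1] := @seq_common_threshold R _ s (fun (g : Lvar p) h =>
  (luxemburg_norm p (fun x => (steklov E h g x - g x)%R) < (eps / 4)%:E)%E).
  move=> g _; apply: steklov_cvg_single => //; first exact: measurable_Lvar.
  exact: modular_Lvar_lty.
exists (Num.min h1 2^-1); first by rewrite lt_min h10 invr_gt0 ltr0n.
move=> h /andP[h0]; rewrite lt_min => /andP[hh1 hh2] f Ff.
have h01 : 0 < h <= 2^-1 by rewrite h0 ltW.
have [g gs] : exists2 g : Lvar p, g \in s & `|f - g| < eta by exact: Hs.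
rewrite -lte_fin Lvar_distE => fg.
have mfg := measurable_Lvar_sub f g.
have if1 := modular_L1_patch (measurable_Lvar f) (modular_Lvar_lty f).
have ig1 := modular_L1_patch (measurable_Lvar g) (modular_Lvar_lty g).
have -> : (fun x => steklov E h f x - f x) =
  (fun x => steklov E h (fun t => f t - g t) x + ((steklov E h g x - g x) + - (f x -
    g x))).
  by apply/funext => x; rewrite steklovB//; ring.
have mS1 : measurable_fun E (steklov E h (fun t => f t - g t)) by exact:
  measurable_steklov.
have mS2 : measurable_fun E (fun x => steklov E h g x - g x).
  by apply: measurable_funB; [apply: measurable_steklov|]; exact: measurable_Lvar.
have mS3 : measurable_fun E (fun x => - (f x - g x)) by exact: measurableT_comp.
rewrite epsE.
apply: luxemburg_normD_lt => //; first exact: measurable_funD.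
  by apply: (le_lt_trans (HK _ _ _ h01 mfg fg)); rewrite etaK lte_fin.
apply: luxemburg_normD_lt => //; first by apply: H1; rewrite ?h0.
by rewrite luxemburg_normN// (lt_le_trans fg)// lee_fin.
Qed.

End necessity.

(** * Sufficiency *)

Section finite_cells.
Context {R : realType}.

(** The members of F are sorted by the integer part [c] of [(phi f t + M) / e], which takes at most
    [m] values, and each class is treated recursively for the other indices. The representatives
    belong to F, so that estimates uniform over F apply to them. *)
Lemma finite_cells (T I : eqType) (s : seq I) (F : set T) (phi : T -> I -> R) (M e :
  R) :
  0 < e -> (forall f t, F f -> t \in s -> `|phi f t| <= M) ->
  exists l : seq T, (forall g, g \in l -> F g) /\
    forall f, F f -> exists2 g, g \in l & forall t, t \in s -> `|phi f t - phi g t|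
      <= e.
Proof.
move=> e0; elim: s F => [|t s IH] F FM.
  have [[g Fg]|nF] := pselect (exists g, F g).
    exists [:: g]; split; first by move=> k; rewrite inE => /eqP ->.
    by move=> f _; exists g; rewrite ?inE.
  by exists [::]; split => // f Ff; exfalso; apply: nF; exists f.
pose c f := Num.truncn ((phi f t + M) / e).
have cP f : F f -> (c f)%:R * e <= phi f t + M < (c f).+1%:R * e.
  move=> Ff; have := FM f t Ff (mem_head _ _); rewrite ler_norml => /andP[h1 h2].
  rewrite -ler_pdivlMr// -ltr_pdivrMr//; apply: truncn_itv.
  by rewrite divr_ge0 ?(ltW e0)//; lra.
pose m := (Num.truncn ((M + M) / e)).+1.
have cm f : F f -> (c f < m)%N.
  move=> Ff; rewrite ltnS /c; have := FM f t Ff (mem_head _ _);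
    rewrite ler_norml => /andP[h1 h2].
  by apply: le_truncn; rewrite ler_pM2r ?invr_gt0// lerD2r.
have /choice[l Hl] : forall k, exists l : seq T,
    (forall g, g \in l -> F g /\ c g = k) /\
    forall f, F f -> c f = k -> exists2 g, g \in l & forall t, t \in s -> `|phi f t -
      phi g t| <= e.
  move=> k; have [f u [Ff _] us|l [l1 l2]] := IH [set f | F f /\ c f = k].
    by apply: FM => //; rewrite in_cons us orbT.
  by exists l; split => // f Ff fk; exact: l2.
exists (flatten [seq l k | k <- iota 0 m]); split.
  by move=> g /flatten_mapP[k _ gl]; have [] := (Hl k).1 _ gl.
move=> f Ff; have [g gl fg] := (Hl (c f)).2 f Ff erefl.
have [Fg cg] := (Hl (c f)).1 _ gl.
exists g; first by apply/flatten_mapP; exists (c f) => //; rewrite mem_iota add0n cm.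
move=> u; rewrite in_cons => /orP[/eqP ->|]; last exact: fg.
have /andP[f1 f2] := cP _ Ff; have /andP[g1 g2] := cP _ Fg; rewrite cg in g1 g2.
move: f1 f2 g1 g2; rewrite -[(c f).+1%:R]natr1 mulrDl mul1r.
set w := (c f)%:R * e => f1 f2 g1 g2.
by rewrite ler_norml; apply/andP; split; lra.
Qed.

End finite_cells.

Section sufficiency.
Context {R : realType} {n : nat} {E : set 'rV[R]_n} (p : bounded_exponent E).
Hypothesis n_gt0 : (0 < n)%N.
Let mu : {measure set 'rV[R]_n -> \bar R} := lebesgue_rV n.
Let mE : measurable E := measurable_exponent_dom p.
Variable rho : R.
Hypothesis Erho : E `<=` euclid_ball 0 rho.
Let Efin : (mu E < +oo)%E := bounded_fin_measure p Erho.
Implicit Types f g : 'rV[R]_n -> R.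

Let i0 : 'I_n := Ordinal n_gt0.

(** The part of the ball where [exp (a x_1)] exceeds its value at the center by the factor
    [exp (a h / 4)]. Its measure is positive, as it contains a point at distance [h / 2] from the
    center. *)
Definition side_ball (y : 'rV[R]_n) (h : R) : set 'rV[R]_n :=
  euclid_ball y h `&` [set x | y ord0 i0 + h / 4 < x ord0 i0].

Lemma open_side_ball y h : open (side_ball y h).
Proof.
apply: openI; first exact: open_euclid_ball.
suff : open ((fun x : 'rV[R]_n => x ord0 i0) @^-1` [set r | y ord0 i0 + h / 4 < r])
  by [].
by apply: open_comp; [move=> x _; exact: coord_continuous|exact: open_gt].
Qed.

Lemma side_ball_neq0 h : 0 < h -> side_ball 0 h !=set0.
Proof.
move=> h0; exists (\row_j (if j == i0 then h / 2 else 0)); split;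
  rewrite /euclid_ball/=.
  rewrite subr0 (le_lt_trans (euclid_norm_le_sum _))//.
  rewrite (bigD1 i0)//= mxE eqxx big1; last by move=> j /negbTE ji;
    rewrite mxE ji normr0.
  by rewrite addr0 gtr0_norm; lra.
by rewrite !mxE eqxx; lra.
Qed.

Lemma side_ball_translate y h : mu (side_ball y h) = mu (side_ball 0 h).
Proof.
rewrite /mu -[RHS](lebesgue_rV_translate y); last by apply: open_measurable_mx;
  exact: open_side_ball.
congr (lebesgue_rV n _); apply/seteqP; split=> x;
  rewrite /side_ball /euclid_ball/= !mxE subr0 add0r.
  move=> [xy h1]; split => //; lra.
by move=> [xy h1]; split => //; lra.
Qed.

(* [w = max 0 (M - exp (a x_1))]: because of the points of [side_ball t h], the
   mean of [exp (a x_1)] over the ball is at least twice its value at [t] when [a]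
   is large. *)
Lemma exists_weight (h : R) : 0 < h -> exists c M : R, exists w : 'rV[R]_n -> R,
  [/\ 0 < c, measurable_fun setT w, forall x, 0 <= w x <= M &
   forall t, E t -> ((unit_ball_volume R n * h ^+ n)^-1%:E *
     (\int[mu]_(x in euclid_ball t h) (w x)%:E) + c%:E <= (w t)%:E)%E].
Proof.
move=> h0; set A := unit_ball_volume R n * h ^+ n.
have A0 : 0 < A by exact: ball_volume_gt0.
have msb y : measurable (side_ball y h) by apply: open_measurable_mx;
  exact: open_side_ball.
have sboo : (mu (side_ball 0 h) < +oo)%E.
  apply: le_lt_trans (lebesgue_rV_ball_lty n h); apply: le_measure; rewrite ?inE//.
  - exact: measurable_euclid_ball.
  - exact: subIsetl.
pose k := fine (mu (side_ball 0 h)).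
have kE y : mu (side_ball y h) = k%:E.
  by rewrite side_ball_translate fineK// ge0_fin_numE ?measure_ge0.
have k0 : 0 < k.
  rewrite -lte_fin -(kE 0); apply: lebesgue_rV_open_gt0; first exact: open_side_ball.
  exact: side_ball_neq0.
(* So [a * (h / 4) = 2 * A / k], and [exp x >= 1 + x] gives [exp (a h / 4) * k >= 2 * A]. *)
pose a := 4 / h * (2 * A / k).
have a0 : 0 <= a.
  apply: mulr_ge0; first by rewrite divr_ge0// ltW.
  by rewrite divr_ge0 ?(ltW k0)// mulr_ge0// ltW.
(* Large enough for the truncation at 0 in [w] to be inactive at all points within [h] of E. *)
pose M := expR (a * (rho + h)).
pose w (x : 'rV[R]_n) := Num.max 0 (M - expR (a * x ord0 i0)).
have M0 : 0 < M by exact: expR_gt0.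
have mc : measurable_fun setT (fun x : 'rV[R]_n => x ord0 i0) by exact:
  measurable_coord_mx.
have mw : measurable_fun setT w.
  apply: measurable_maxr => //; apply: measurable_funB => //.
  apply: measurableT_comp => //; exact: measurable_funM.
have w01 x : 0 <= w x <= M.
  rewrite le_max lexx/= ge_max (ltW M0)/= gerBl expR_ge0//.
(* The gain at [t] is [exp (a t_1)], and [t_1 > - rho] on E. *)
exists (expR (- (a * rho))), M, w; split => //; first exact: expR_gt0.
move=> t Et.
have t1 : `|t ord0 i0| < rho.
  by have := Erho Et; rewrite /euclid_ball/= subr0; apply: le_lt_trans;
    exact: coord_le_euclid_norm.
have wt : w t = M - expR (a * t ord0 i0).
  rewrite /w max_r// subr_ge0 ler_expR ler_wpM2l//.
  by move: t1; rewrite ltr_norml => /andP[]; lra.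
pose d := expR (a * (t ord0 i0 + h / 4)).
have d0 : 0 <= d by exact: expR_ge0.
have dM : d <= M.
  by rewrite ler_expR ler_wpM2l//; move: t1; rewrite ltr_norml => /andP[]; lra.
have mB := measurable_euclid_ball t h.
have mwB : measurable_fun (euclid_ball t h) (fun x => (w x)%:E).
  by apply/measurable_EFinP; exact: measurable_funTS.
(* This integrates [w + d * 1_(side_ball t h) <= M] over the ball: on the side part
   [exp (a x_1) >= d]. *)
have key : ((\int[mu]_(x in euclid_ball t h) (w x)%:E) + (d * k)%:E <= (M * A)%:E)%E.
  have -> : ((d * k)%:E = \int[mu]_(x in euclid_ball t h) (d%:E * (\1_(side_ball t h)
    x)%:E))%E.
    rewrite ge0_integralZl//; last by apply/measurable_EFinP; exact: measurable_indic.
    by rewrite integral_indic// setIidl ?kE -?EFinM//; exact: subIsetl.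
  rewrite EFinM -(lebesgue_rV_ball t h0) -/(mu _) -integral_cst// -ge0_integralD//;
    last 3 first.
  - by move=> x _; rewrite lee_fin; case/andP: (w01 x).
  - by move=> x _; rewrite mule_ge0// lee_fin.
  - by apply: emeasurable_funM => //; apply/measurable_EFinP; exact: measurable_indic.
  apply: ge0_le_integral => //.
  - by move=> x _; rewrite adde_ge0 ?mule_ge0 ?lee_fin//; case/andP: (w01 x).
  - by apply: emeasurable_funD => //; apply: emeasurable_funM => //;
    apply/measurable_EFinP; exact: measurable_indic.
  move=> x _; rewrite -EFinM -EFinD lee_fin indicE.
  have [|_] := boolP (x \in _); last by rewrite mulr0 addr0; case/andP: (w01 x).
  rewrite inE => -[_ /= tx]; rewrite mulr1 -lerBrDr /w ge_max subr_ge0 dM/= lerD2l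
    lerN2.
  by rewrite ler_expR ler_wpM2l// ltW.
have Ifin : (\int[mu]_(x in euclid_ball t h) (w x)%:E)%E \is a fin_num.
  rewrite ge0_fin_numE; last by apply: integral_ge0 => x _; rewrite lee_fin;
    case/andP: (w01 x).
  apply: (@le_lt_trans _ _ (M * A)%:E); last exact: ltry.
  by apply: le_trans key; rewrite leeDl// lee_fin mulr_ge0// ltW.
move: key; rewrite -(fineK Ifin) -EFinD -EFinM -EFinD !lee_fin wt.
set I := fine _ => key.
have ek : 2 * A <= expR (a * (h / 4)) * k.
  have -> : a * (h / 4) = 2 * A / k by rewrite /a; field; rewrite !gt_eqF.
  rewrite -ler_pdivrMr//; apply: le_trans (expR_ge1Dx _); lra.
have dE : d = expR (a * t ord0 i0) * expR (a * (h / 4)) by rewrite /d mulrDr expRD.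
have u0 := expR_ge0 (a * t ord0 i0).
have dk : expR (a * t ord0 i0) * (2 * A) <= d * k by rewrite dE -mulrA ler_wpM2l.
have IA : A^-1 * I <= M - 2 * expR (a * t ord0 i0).
  by rewrite mulrC ler_pdivrMr//; lra.
have cu : expR (- (a * rho)) <= expR (a * t ord0 i0).
  rewrite ler_expR -mulrN ler_wpM2l//.
  by move: t1; rewrite ltr_norml => /andP[]; lra.
lra.
Qed.

(** Self-adjointness and the weight give [IS + c * If <= Iw], while the triangle inequality bounds
    [Iw] by [IS] plus [M] times the L^1 norm of [steklov E h f - f]. The finite quantity [IS]
    cancels, whence the constant [M / c]. *)
Lemma L1_norm_le_steklov_sub (h : R) : 0 < h -> exists2 C : R, 0 <= C &
  forall f, measurable_fun E f -> (\int[mu]_(x in E) `|f x|%:E < +oo)%E ->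
    (\int[mu]_(x in E) `|f x|%:E <= C%:E * \int[mu]_(x in E) `|steklov E h f x - f
      x|%:E)%E.
Proof.
move=> h0; have [c [M [w [c0 mw w01 wle]]]] := exists_weight h0.
have w0 x : 0 <= w x by case/andP: (w01 x).
have wM x : w x <= M by case/andP: (w01 x).
have M0 : 0 <= M by exact: le_trans (w0 0) (wM 0).
exists (M / c); first by rewrite divr_ge0// ltW.
move=> f mf foo; set If := (\int[mu]_(x in E) `|f x|%:E)%E.
have ig := integrable_patch mE mf foo.
have mwE : measurable_fun E (fun x => (w x)%:E) by apply/measurable_EFinP;
  exact: measurable_funTS.
have mfE : measurable_fun E (fun x => `|f x|%:E) by apply/measurable_EFinP;
  exact: measurableT_comp.
have mS : measurable_fun E (steklov E h f) by exact: (measurable_steklov p).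
have mSE : measurable_fun E (fun x => `|steklov E h f x|%:E) by
  apply/measurable_EFinP; exact: measurableT_comp.
have mSf : measurable_fun E (fun x => `|steklov E h f x - f x|%:E).
  by apply/measurable_EFinP; apply: measurableT_comp => //; exact: measurable_funB.
set A := unit_ball_volume R n * h ^+ n in wle.
have A0 : 0 < A^-1 by exact: ball_volumeV_gt0.
pose Iw := (\int[mu]_(x in E) ((w x)%:E * `|f x|%:E))%E.
have Iw0 : (0 <= Iw)%E by apply: integral_ge0 => x _; rewrite mule_ge0 ?lee_fin.
have Iwfin : Iw \is a fin_num.
  rewrite ge0_fin_numE//; apply: (@le_lt_trans _ _ (M%:E * If)%E); last first.
    by rewrite lte_mul_pinfty ?lee_fin// ge0_fin_numE// integral_ge0.
  rewrite -ge0_integralZl ?lee_fin//; apply: ge0_le_integral => //.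
  - by move=> x _; rewrite mule_ge0 ?lee_fin.
  - exact: emeasurable_funM.
  - exact: emeasurable_funM.
  - by move=> x _; rewrite -!EFinM lee_fin ler_wpM2r.
pose IS := (\int[mu]_(x in E) ((w x)%:E * `|steklov E h f x|%:E))%E.
have IS0 : (0 <= IS)%E by apply: integral_ge0 => x _; rewrite mule_ge0 ?lee_fin.
have h1 : (IS + c%:E * If <= Iw)%E.
  (* Cutting the weight to E restricts the integral of the mean to E, and only lowers the ball means
     of the weight. *)
  pose phi := (fun x => (w x)%:E) \_ E.
  have phi0 x : (0 <= phi x)%E by rewrite /phi patchE; case: ifP; rewrite ?lee_fin.
  have mphi : measurable_fun setT phi by apply/(measurable_restrictT _ mE).
  have := ball_mean_weight h0 ig mphi phi0.
  rewrite [X in (X <= _)%E -> _](_ : _ = IS); last first.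
    rewrite /IS [RHS]integral_mkcond; apply: eq_integral => x _.
    by rewrite /phi !patchE; case: ifP; rewrite ?mul0e.
  set J := (X in (_ <= X)%E -> _) => ISJ.
  have mb : measurable_fun setT (fun t => \int[mu]_(x in euclid_ball t h) phi x)%E.
    exact: measurable_ball_integral.
  have b0 t : (0 <= \int[mu]_(x in euclid_ball t h) phi x)%E by exact: integral_ge0.
  pose b t := (A^-1%:E * \int[mu]_(x in euclid_ball t h) phi x)%E.
  have mbE : measurable_fun E b by apply: emeasurable_funM => //;
    exact: measurable_funTS.
  have bb0 t : (0 <= b t)%E by rewrite mule_ge0// lee_fin ltW.
  have JE : J = (\int[mu]_(t in E) (b t * `|f t|%:E))%E.
    rewrite /J -ge0_integralZl//; last 3 first.
    - apply: emeasurable_funM => //; apply/measurable_EFinP;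
      apply: measurableT_comp => //.
      exact: measurable_L1 ig.
    - by move=> t _; rewrite mule_ge0.
    - by rewrite lee_fin ltW.
    rewrite [RHS]integral_mkcond; apply: eq_integral => t _.
    rewrite !patchE; case: ifP => _; last by rewrite normr0 mul0e mule0.
    by rewrite /b [X in (_ * X)%E]muleC muleA.
  apply: (@le_trans _ _ (J + c%:E * If)%E); first by rewrite leeD2r.
  rewrite JE /If -ge0_integralZl ?lee_fin ?(ltW c0)// -ge0_integralD//; last 4 first.
  - by move=> t _; rewrite mule_ge0.
  - exact: emeasurable_funM.
  - by move=> t _; rewrite mule_ge0// lee_fin ltW.
  - exact: emeasurable_funM.
  apply: ge0_le_integral => //.
  - by move=> t _; rewrite adde_ge0 ?mule_ge0// lee_fin ltW.
  - by apply: emeasurable_funD; exact: emeasurable_funM.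
  - exact: emeasurable_funM.
  move=> t Et; rewrite -ge0_muleDl//; last by rewrite lee_fin ltW.
  apply: lee_wpmul2r => //; apply: le_trans (wle t Et).
  apply: leeD => //; apply: lee_wpmul2l; first by rewrite lee_fin ltW.
  have mB := measurable_euclid_ball t h.
  apply: ge0_le_integral => //.
  - exact: measurable_funTS.
  - by apply/measurable_EFinP; exact: measurable_funTS.
  - by move=> x _; rewrite /phi patchE; case: ifP; rewrite ?lee_fin.
have h2 : (Iw <= M%:E * \int[mu]_(x in E) `|steklov E h f x - f x|%:E + IS)%E.
  rewrite -ge0_integralZl ?lee_fin// -ge0_integralD//; last 4 first.
  - by move=> x _; rewrite mule_ge0 ?lee_fin.
  - by apply: emeasurable_funM.
  - by move=> x _; rewrite mule_ge0 ?lee_fin.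
  - by apply: emeasurable_funM.
  apply: ge0_le_integral => //.
  - by move=> x _; rewrite mule_ge0 ?lee_fin.
  - exact: emeasurable_funM.
  - by apply: emeasurable_funD; exact: emeasurable_funM.
  move=> x _; rewrite -!EFinM -EFinD lee_fin.
  apply: (@le_trans _ _ (w x * (`|steklov E h f x - f x| + `|steklov E h f x|))).
    rewrite ler_wpM2l//; have := ler_normB (steklov E h f x) (steklov E h f x - f x).
    by rewrite subKr addrC.
  by rewrite mulrDr lerD2r ler_wpM2r.
have ISfin : IS \is a fin_num.
  rewrite ge0_fin_numE//; apply: (@le_lt_trans _ _ Iw); last by rewrite -ge0_fin_numE.
  by apply: le_trans h1; rewrite leeDl// mule_ge0 ?lee_fin ?(ltW c0)// integral_ge0.
have : (IS + c%:E * If <= IS + M%:E * \int[mu]_(x in E) `|steklov E h f x - f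
  x|%:E)%E.
  by rewrite (le_trans h1)// (le_trans h2)// addeC.
rewrite leeD2lE// => h3.
apply: (@le_trans _ _ (c^-1%:E * (c%:E * If))%E).
  by rewrite muleA -EFinM mulVf ?gt_eqF// mul1e.
rewrite mulrC EFinM -muleA; apply: lee_wpmul2l => //.
by rewrite lee_fin invr_ge0 ltW.
Qed.

End sufficiency.

(** * Equicontinuity of the means of bounded functions *)

Section equicontinuity.
Context {R : realType} {n : nat}.
Let mu : {measure set 'rV[R]_n -> \bar R} := lebesgue_rV n.
Implicit Types (g : 'rV[R]_n -> R).

(** Each ball of radius [h] lies in the concentric enlargement of the other, so the symmetric
    difference is covered by two shells of thickness [d], whose volumes are explicit. *)
Lemma ball_indic_sub (h d : R) (x y z : 'rV[R]_n) : 0 <= d -> euclid_norm (x - y) <=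
  d ->
  `|\1_(euclid_ball x h) z - \1_(euclid_ball y h) z| <=
  (\1_(euclid_ball x (h + d)) z - \1_(euclid_ball x h) z) +
  (\1_(euclid_ball y (h + d)) z - \1_(euclid_ball y h) z) :> R.
Proof.
move=> d0 xyd.
have sub u : euclid_ball u h `<=` euclid_ball u (h + d) by apply: le_euclid_ball;
  rewrite lerDl.
have xy : euclid_ball x h `<=` euclid_ball y (h + d).
  move=> t; rewrite /euclid_ball/= => xt;
    rewrite (le_lt_trans (euclid_norm_distD x _ _))//.
  by rewrite ltr_leD.
have yx : euclid_ball y h `<=` euclid_ball x (h + d).
  move=> t; rewrite /euclid_ball/= => xt;
    rewrite (le_lt_trans (euclid_norm_distD y _ _))//.
  by rewrite ltr_leD// euclid_normB.
rewrite !indicE.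
have [xz|xz] := boolP (z \in euclid_ball x h);
  have [yz|yz] := boolP (z \in euclid_ball y h).
- by rewrite inE in xz; rewrite inE in yz; rewrite !mem_set//=;
  [rewrite !subrr normr0 addr0|exact: sub|exact: sub].
- by rewrite inE in xz; rewrite !mem_set//=;
  [rewrite subrr subr0 normr1 add0r|exact: xy|exact: sub].
- by rewrite inE in yz; rewrite !mem_set//=;
  [rewrite subrr subr0 sub0r normrN normr1 addr0|exact: sub|exact: yx].
- by rewrite subrr normr0 !subr0 addr_ge0.
Qed.

Lemma Rintegral_ball (h : R) x : 0 < h ->
  \int[mu]_z (\1_(euclid_ball x h) z : R) = unit_ball_volume R n * h ^+ n.
Proof.
move=> h0; rewrite /Rintegral integral_indic ?setIT ?[mu _]lebesgue_rV_ball//.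
exact: measurable_euclid_ball.
Qed.

Lemma L1_ball (h : R) x : 0 < h -> mu.-integrable setT (EFin \o (\1_(euclid_ball x h)
  : _ -> R)).
Proof.
move=> h0; apply: L1_indic; first exact: measurable_euclid_ball.
by rewrite lebesgue_rV_ball// ltry.
Qed.

Lemma ball_mean_sub_le (h d M : R) g x y : 0 < h -> 0 <= d -> 0 <= M ->
  mu.-integrable setT (EFin \o g) -> (forall z, `|g z| <= M) -> euclid_norm (x - y)
    <= d ->
  `|ball_mean h g x - ball_mean h g y| <= (unit_ball_volume R n * h ^+ n)^-1 *
    (M * (2 * (unit_ball_volume R n * (h + d) ^+ n - unit_ball_volume R n * h ^+ n))).
Proof.
move=> h0 d0 M0 ig gM xyd; have hd0 : 0 < h + d by lra.
have v0 := ball_volumeV_gt0 (n := n) h0.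
rewrite /ball_mean -mulrBr normrM (gtr0_norm v0) ler_wpM2l ?(ltW v0)//.
have mB (u : 'rV[R]_n) := measurable_euclid_ball u h.
have iB u : mu.-integrable setT (EFin \o (g \_ (euclid_ball u h))).
  by rewrite -restrict_EFin; exact: ((integrable_mkcond (EFin \o g) (mB u)).1
    (integrable_ball h u ig)).
rewrite [X in X - _]Rintegral_mkcond [X in _ - X]Rintegral_mkcond -RintegralB//.
have iD := L1B (iB x) (iB y).
apply: (le_trans (le_normr_Rintegral measurableT iD)).
have iK (u : 'rV[R]_n) := L1B (L1_ball u hd0) (L1_ball u h0).
have iKK := L1D (iK x) (iK y).
have iMK := L1Z M iKK.
apply: (@le_trans _ _ (\int[mu]_z (M * ((\1_(euclid_ball x (h + d)) z -
  \1_(euclid_ball x h) z) +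
  (\1_(euclid_ball y (h + d)) z - \1_(euclid_ball y h) z)))%R)).
  apply: le_Rintegral => //; first exact: integrable_norm iD.
  move=> z _; rewrite (_ : _ - _ = g z * (\1_(euclid_ball x h) z - \1_(euclid_ball y
    h) z)).
    by rewrite normrM ler_pM// ball_indic_sub.
  rewrite !patchE !indicE mulrBr; case: ifP => _; case: ifP => _;
    rewrite ?mulr1 ?mulr0//.
rewrite RintegralZl// RintegralD// !RintegralB//; try exact: L1_ball.
by rewrite !Rintegral_ball// ler_wpM2l// mulr2n mulrDl !mul1r.
Qed.

(** The shell volume is a polynomial in [d] that vanishes at 0, and the resulting bound involves
    neither [g] nor the points. *)
Lemma ball_mean_equicontinuous (h M e : R) : 0 < h -> 0 <= M -> 0 < e ->
  exists2 d : R, 0 < d & forall g, mu.-integrable setT (EFin \o g) -> (forall z, `|g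
    z| <= M) ->
    forall x y, euclid_norm (x - y) <= d -> `|ball_mean h g x - ball_mean h g y| <= e.
Proof.
move=> h0 M0 e0.
pose F (d : R) := (unit_ball_volume R n * h ^+ n)^-1 *
    (M * (2 * (unit_ball_volume R n * (h + d) ^+ n - unit_ball_volume R n * h ^+ n))).
have F0 : F 0 = 0 by rewrite /F addr0 subrr !mulr0.
have cF : F d @[d --> (0:R)] --> F 0.
  apply: cvgMr; apply: cvgMr; apply: cvgMr; apply: cvgB; last exact: cvg_cst.
  apply: cvgMr; apply: (cvg_comp (fun d : R => h + d) (fun r : R => r ^+ n)).
    by apply: cvgD; [exact: cvg_cst|exact: cvg_id].
  exact: exprn_continuous.
move: cF; rewrite F0 => /cvgrPdist_le /(_ _ e0) /nbhs_ballP[r /= r0 Hr].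
exists (r / 2); first by rewrite divr_gt0.
move=> g ig gM x y xy; apply: (le_trans (ball_mean_sub_le h0 _ M0 ig gM xy)).
  by rewrite divr_ge0// ltW.
have := Hr (r / 2); rewrite /= sub0r normrN => H.
apply: (le_trans (ler_norm _)); apply: H.
by rewrite /ball/= sub0r normrN gtr0_norm; lra.
Qed.

End equicontinuity.

Lemma close_trans (R : realType) (a b c d u v w : R) : `|a - b| <= u -> `|b - c| <= v
  -> `|d - c| <= w ->
  `|a - d| <= u + (v + w).
Proof.
move=> h1 h2 h3; have -> : a - d = (a - b) + ((b - c) - (d - c)) by ring.
by rewrite (le_trans (ler_normD _ _))// lerD// (le_trans (ler_normB _ _))// lerD.
Qed.

Lemma compact_euclid_net (R : realType) (n : nat) (E : set 'rV[R]_n) (d : R) :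
  compact E -> 0 < d ->
  exists s : seq 'rV[R]_n, forall x, E x -> exists2 t, t \in s & euclid_norm (x - t)
    < d.
Proof.
move=> cE d0; move: cE; rewrite compact_cover => /(_ _ setT (fun t => euclid_ball t
  d)).
case=> [t _|x _|D _ ED].
- exact: open_euclid_ball.
- by exists x => //; exact: euclid_ball_center.
exists (finmap.enum_fset D) => x Ex; have [t tD xt] := ED _ Ex.
by exists t.
Qed.

(** * Total boundedness of the family *)

Section total_boundedness.
Context {R : realType} {n : nat} {E : set 'rV[R]_n} (p : bounded_exponent E).
Hypothesis n_gt0 : (0 < n)%N.
Let mu : {measure set 'rV[R]_n -> \bar R} := lebesgue_rV n.
Let mE : measurable E := measurable_exponent_dom p.
Variable rho : R.
Hypothesis Erho : E `<=` euclid_ball 0 rho.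
Let Efin : (mu E < +oo)%E := bounded_fin_measure p Erho.
Variable F : set (Lvar p).
Hypothesis FS : forall eps : R, 0 < eps -> exists2 h0 : R, 0 < h0 &
  forall h : R, 0 < h < h0 -> forall f : Lvar p, F f ->
    (luxemburg_norm p (fun x => (steklov E h f x - f x)%R) < eps%:E)%E.

Let m := fine (mu E) + 1.
Let m0 : 0 < m. Proof. by rewrite ltr_wpDl// fine_ge0// measure_ge0. Qed.

Lemma uniform_step (eps : R) : 0 < eps -> exists2 h : R, 0 < h & forall f : Lvar p, F
  f ->
  (luxemburg_norm p (fun x => (steklov E h f x - f x)%R) < eps%:E)%E.
Proof.
move=> /FS[h0 h00 H]; exists (h0 / 2); first by rewrite divr_gt0.
by apply: H; rewrite divr_gt0//=; lra.
Qed.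

Let L1f (f : Lvar p) : mu.-integrable setT (EFin \o (f \_ E)).
Proof. exact: (modular_L1_patch Erho (measurable_Lvar f) (modular_Lvar_lty f)). Qed.

Let measurable_stek h (f : Lvar p) : measurable_fun E (steklov E h f).
Proof. by apply: (measurable_steklov p); exact: measurable_Lvar. Qed.

Let measurable_stek_sub h (f : Lvar p) : measurable_fun E (fun x => steklov E h f x -
  f x).
Proof. by apply: measurable_funB;
  [exact: measurable_stek|exact: measurable_Lvar]. Qed.

(** A single radius, for which [steklov h f - f] has norm below 1 on the whole family, already
    bounds the family by [L1_norm_le_steklov_sub]. *)
Lemma uniform_L1_bound : exists2 L : R, 0 <= L &
  forall f : Lvar p, F f -> (\int[mu]_x `|(f \_ E) x|%:E <= L%:E)%E.
Proof.
have [h h0 H] := uniform_step ltr01.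
have [C C0 HC] := L1_norm_le_steklov_sub p n_gt0 Erho h0.
exists (C * m); first by rewrite mulr_ge0// ltW.
move=> f Ff; rewrite integral_patch_norm.
have foo : (\int[mu]_(x in E) `|f x|%:E < +oo)%E.
  by rewrite -integral_patch_norm; have /integrableP[_] := L1f f.
apply: (le_trans (HC _ (measurable_Lvar f) foo)); rewrite EFinM.
apply: lee_wpmul2l; first by rewrite lee_fin.
have := integral_le_luxemburg Efin (measurable_stek_sub h f) (H f Ff).
by rewrite mul1r.
Qed.

Lemma uniform_steklov_sup (h : R) : 0 < h -> exists2 B : R, 0 <= B &
  forall f : Lvar p, F f -> forall x, `|steklov E h f x| <= B.
Proof.
move=> h0; have [L L0 HL] := uniform_L1_bound.
exists ((unit_ball_volume R n * h ^+ n)^-1 * L).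
  by rewrite mulr_ge0// ltW// ball_volumeV_gt0.
move=> f Ff x; rewrite steklovE; apply: (ball_mean_norm_le_L1 _ h0 (L1f f)).
exact: HL.
Qed.

(* Boundedness in L^1 alone is not enough: the equi-integrability comes from
   splitting [f] into [steklov k f], which is uniformly bounded, and a remainder
   that is uniformly small in L^1. *)
Lemma uniform_equicontinuous (h e : R) : 0 < h -> 0 < e -> exists2 d : R, 0 < d &
  forall f : Lvar p, F f -> forall x y, euclid_norm (x - y) <= d ->
    `|steklov E h f x - steklov E h f y| <= e.
Proof.
move=> h0 e0; have c0 := ball_volumeV_gt0 (n := n) h0.
set c := (_^-1) in c0.
(* The factor [m] converts the norm into the L^1 norm, and [c] the L^1 norm into a sup bound on
   means of radius [h]. The remainder thus costs [e / 4] at each of the two points, and the bounded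
   part [e / 2] for their difference. *)
pose eta := e / 4 / (c * m).
have cm0 : 0 < c * m by rewrite mulr_gt0.
have e4 : 0 < e / 4 by rewrite divr_gt0.
have e2 : 0 < e / 2 by rewrite divr_gt0.
have eE : e / 2 + (e / 4 + e / 4) = e by lra.
have eta0 : 0 < eta by rewrite divr_gt0.
have etaE : c * (eta * m) = e / 4 by rewrite mulrCA /eta divfK// gt_eqF.
have [k k0 Hk] := uniform_step eta0.
have [B B0 HB] := uniform_steklov_sup k0.
have [d d0 Hd] := @ball_mean_equicontinuous R n h B (e / 2) h0 B0 e2.
exists d => // f Ff x y xy.
have mu1 := measurable_stek k f.
have uoo : (\int[mu]_(x in E) `|steklov E k f x|%:E < +oo)%E.
  have /integrableP[_] := integrable_ball_mean k0 (L1f f).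
  apply: le_lt_trans; apply: ge0_subset_integral => //.
  apply/measurable_EFinP; apply: measurableT_comp => //.
  by apply: measurable_ball_mean; exact: measurable_L1 (L1f f).
have iu := integrable_patch mE mu1 uoo.
have iB := L1B (L1f f) iu.
have rE z : `|ball_mean h (fun t => (f \_ E) t - (steklov E k f \_ E) t) z| <= e / 4.
  rewrite -etaE; apply: ball_mean_norm_le_L1 => //.
  rewrite (eq_integral (fun x => `|((fun t => steklov E k f t - f t) \_ E) x|%:E));
    last first.
    by move=> t _; rewrite patchB distrC.
  rewrite integral_patch_norm; apply: integral_le_luxemburg => //.
  exact: Hk.
have dec z : steklov E h f z = ball_mean h (steklov E k f \_ E) z +
    ball_mean h (fun t => (f \_ E) t - (steklov E k f \_ E) t) z.
  by rewrite steklovE (ball_meanB _ _ (L1f f) iu) addrC subrK.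
have gB z : `|(steklov E k f \_ E) z| <= B.
  by rewrite patchE; case: ifP => _; [exact: HB|rewrite normr0].
have := Hd _ iu gB x y xy; rewrite !dec => h1.
rewrite opprD addrACA (le_trans (ler_normD _ _))// -eE lerD//.
by rewrite (le_trans (ler_normB _ _))// lerD.
Qed.

Variable P : R.
Hypothesis pP : forall x, E x -> p x <= P.

(** A discrete Arzela-Ascoli argument: equicontinuity reduces the sup distance of two means on E to
    their values on a finite net of E, which [finite_cells] sorts. Two members of a cell have means
    close in sup norm, hence in the norm, and each is close to its own mean. *)
Lemma uniform_totally_bounded (e : R) : compact E -> 0 < e ->
  exists l : seq (Lvar p), forall f, F f -> exists2 g, g \in l & `|f - g| < e.
Proof.
move=> cE e0; have e3 : 0 < e / 3 by rewrite divr_gt0.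
have eE : e = e / 3 + (e / 3 + e / 3) by lra.
have [h h0 Hh] := uniform_step e3.
have [d d0 Hd] := luxemburg_norm_small_sup Efin pP e3.
have d3 : 0 < d / 3 by rewrite divr_gt0.
have dE : d = d / 3 + (d / 3 + d / 3) by lra.
have [r r0 Hr] := uniform_equicontinuous h0 d3.
have [s Hs] := compact_euclid_net cE r0.
have [B B0 HB] := uniform_steklov_sup h0.
have [l [lF Hl]] := @finite_cells R (Lvar p) 'rV[R]_n s F (fun (f : Lvar p) t =>
  steklov E h f t) B _ d3
  (fun (f : Lvar p) t Ff _ => HB f Ff t).
exists l => f Ff; have [g gl fg] : exists2 g : Lvar p, g \in l &
  forall t, t \in s -> `|steklov E h f t - steklov E h g t| <= d / 3 by exact: Hl.
exists g => //.
have Fg := lF _ gl.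
have mf := measurable_stek_sub h f; have mg := measurable_stek_sub h g.
have mSS : measurable_fun E (fun x => steklov E h f x - steklov E h g x).
  by apply: measurable_funB.
have mNf : measurable_fun E (fun x => - (steklov E h f x - f x)) by exact:
  measurableT_comp.
rewrite -lte_fin Lvar_distE.
have -> : (fun x => f x - g x) = (fun x => (steklov E h f x - steklov E h g x) +
    (- (steklov E h f x - f x) + (steklov E h g x - g x))).
  by apply/funext => x; ring.
rewrite eE; apply: luxemburg_normD_lt => //; first exact: measurable_funD.
  apply: Hd => // x Ex; have [t ts xt] := Hs _ Ex.
  have h1 := Hr f Ff x t (ltW xt); have h2 := Hr g Fg x t (ltW xt);
    have h3 := fg t ts.
  rewrite dE; exact: close_trans h1 h3 h2.
apply: luxemburg_normD_lt => //; last exact: Hh.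
by rewrite luxemburg_normN//; exact: Hh.
Qed.

Lemma steklov_uniform_compact : compact E -> compact (closure F).
Proof.
move=> cE; apply: totally_bounded_compact_closure; first exact: Lvar_fast_cauchy.
by move=> e e0; exact: uniform_totally_bounded.
Qed.

End total_boundedness.

Lemma bounded_closure_euclid_ball (R : realType) (n : nat) (A : set 'rV[R]_n) :
  bounded_set A -> exists rho : R, closure A `<=` euclid_ball 0 rho.
Proof.
(* [bounded_set] gives bounds strictly above [M], here [M + 1]; the factor [n] passes to the
   Euclidean norm, and the last 1 is the distance from [x] to a point of [A]. *)
move=> [M [_ HM]]; exists (n%:R * (M + 1) + 1) => x Ax.
have [y [Ay xy]] := Ax _ (open_nbhs_nbhs (conj (@open_euclid_ball R n x 1)
  (euclid_ball_center x ltr01))).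
rewrite /euclid_ball/= subr0 -[x](subrK y) addrC (le_lt_trans (euclid_normD _ _))//.
rewrite ler_ltD//; last by rewrite euclid_normB.
rewrite (le_trans (euclid_norm_le_norm _))// ler_wpM2l//.
by apply: (HM (M + 1)) => //; rewrite ltrDl.
Qed.

Theorem theorem15 (R : realType) (n : nat) (n_gt0 : (0 < n)%N)
    (Omega : set 'rV[R]_n) (Omega_open : open Omega)
    (Omega_bounded : bounded_set Omega)
    (p : bounded_exponent (closure Omega))
    (p_Pinfty : Pinfty p) (p_wLip : wLip p)
    (F : set (Lvar p)) :
  compact (closure F) <->
  (forall eps : R, 0 < eps ->
    exists2 h0 : R, 0 < h0 &
      forall h : R, 0 < h < h0 -> forall f : Lvar p, F f ->
        (luxemburg_norm p
           (fun x => (steklov (closure Omega) h f x - f x)%R) < eps%:E)%E).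
Proof.
have [rho Orho] := bounded_closure_euclid_ball Omega_bounded.
have [P P1 pP] := Pinfty_bounded p_Pinfty.
split=> [cF|FS]; first exact: (compact_steklov_uniform Orho P1 pP).
apply: (steklov_uniform_compact n_gt0 Orho FS pP).
apply: bounded_closed_compact; last exact: closed_closure.
exists rho; split; first exact: num_real.
move=> M rM x /Orho; rewrite /euclid_ball/= subr0 => xr.
by rewrite (le_trans (norm_le_euclid_norm x))// ltW// (lt_trans xr).
Qed.
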